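(* The category $\mathbf{DRC}$ of DRC-semigroups (with DRC-morphisms) is isomorphic to the category $\mathbf{CPC}$ of chained projection categories (with chained projection functors).
   Context: \textbf{DRC-semigroups.} A DRC-semigroup is an algebra $(S,\cdot,D,R)$ where $(S,\cdot)$ is a semigroup and $D,R:S\to S$ are unary operations satisfying, for all $a,b\in S$: $D(a)a=a$, $aR(a)=a$; $D(ab)=D(aD(b))$, $R(ab)=R(R(a)b)$; $D(ab)=D(a)D(ab)D(a)$, $R(ab)=R(b)R(ab)R(b)$; $R(D(a))=D(a)$, $D(R(a))=R(a)$. A DRC-morphism is a map preserving $\cdot$, $D$ and $R$; $\mathbf{DRC}$ is the category of DRC-semigroups and DRC-morphisms. \textbf{Projection algebras.} Maps are written to the right of their arguments and composed left to right ($p\,\alpha\beta=(p\alpha)\beta$). A projection algebra is a set $P$ with two families of maps $\theta_p,\delta_p:P\to P$ ($p\in P$) such that for all $p,q\in P$: $p\theta_p=p$, $p\delta_p=p$; $p\theta_{q\theta_p}=q\theta_p$, $p\delta_{q\delta_p}=q\delta_p$; $\theta_q\theta_{q\theta_p}=\theta_q\theta_p$, $\delta_q\delta_{q\delta_p}=\delta_q\delta_p$; $\theta_p\delta_p=\theta_p$, $\delta_p\theta_p=\delta_p$; $\theta_{p\delta_q}\theta_p=\theta_q\theta_p$, $\delta_{p\theta_q}\delta_p=\delta_q\delta_p$. It is partially ordered by $p\le q\iff p=p\theta_q$ (equivalently $p=p\delta_q$). Write $p\,\mathscr F\,q$ iff $p=q\delta_p$ and $q=p\theta_q$. A projection algebra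 morphism $\phi:P\to P'$ satisfies $(q\theta_p)\phi=(q\phi)\theta'_{p\phi}$ and $(q\delta_p)\phi=(q\phi)\delta'_{p\phi}$. \textbf{Biordered categories.} A small category $\mathcal C$ is identified with its set of morphisms; objects are identified with identity morphisms, forming $v\mathcal C$; $\mathbf d,\mathbf r:\mathcal C\to v\mathcal C$ are domain and codomain, and $a\circ b$ is defined iff $\mathbf r(a)=\mathbf d(b)$ (composition left to right). A left-ordered category is $(\mathcal C,\le)$ with a partial order such that: $a\le b$ implies $\mathbf d(a)\le\mathbf d(b)$ and $\mathbf r(a)\le \mathbf r(b)$; if $a\le b$, $c\le c'$, $\mathbf r(a)=\mathbf d(c)$, $\mathbf r(b)=\mathbf d(c')$ then $a\circ c\le b\circ c'$; for every object $p\le\mathbf d(a)$ there is a unique $u\le a$ with $\mathbf d(u)=p$, written ${}_p\lfloor a$ (left restriction). A right-ordered category is defined dually, with unique $v\le a$ having $\mathbf r(v)=q$ for each object $q\le\mathbf r(a)$, written $a\rfloor_q$. A biordered category is $(\mathcal C,\le_l,\le_r)$ with $(\mathcal C,\le_l)$ left-ordered, $(\mathcal C,\le_r)$ right-ordered, and $\le_l,\le_r$ agreeing on $v\mathcal C$. A biordered morphism is a functor preserving both orders. Write $\mathcal C(q,r)=\{a:\mathbf d(a)=q,\mathbf r(a)=r\}$ and $t^{\downarrow}=\{s:s\le t\}$. \textbf{Projection categories.} A weak projection category is a pair $(P,\mathcal C)$ with $\mathcal C$ biordered, $P=v\mathcal C$ a projection algebra, and both $\le_l,\le_r$ restricting on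 $P$ to the projection algebra order. For $a\in\mathcal C$ define $\vartheta_a:\mathbf d(a)^\downarrow\to\mathbf r(a)^\downarrow$, $p\vartheta_a=\mathbf r({}_p\lfloor a)$, and $\vartheta'_a:\mathbf r(a)^\downarrow\to\mathbf d(a)^\downarrow$, $q\vartheta'_a=\mathbf d(a\rfloor_q)$; and $\Theta_a=\theta_{\mathbf d(a)}\vartheta_a:P\to P$, $\Delta_a=\delta_{\mathbf r(a)}\vartheta'_a:P\to P$. A projection category is a weak projection category such that (C1) for all $a\in\mathcal C$, $p\le\mathbf d(a)$, $q\le\mathbf r(a)$: $\Theta_{a\rfloor_q}=\Theta_a\theta_q$ and $\Delta_{{}_p\lfloor a}=\Delta_a\delta_p$. \textbf{Chain category.} For a projection algebra $P$, a path is a tuple $(p_1,\dots,p_k)$, $k\ge1$, with $p_1\,\mathscr F\,p_2\,\mathscr F\cdots\mathscr F\,p_k$; $\mathbf d=p_1$, $\mathbf r=p_k$, composition $(p_1,\dots,p_k)\circ(p_k,\dots,p_l)=(p_1,\dots,p_l)$, objects $(p)\equiv p$. Restrictions: for $q\le p_1$, ${}_q\lfloor(p_1,\dots,p_k)=(q_1,\dots,q_k)$ with $q_1=q$, $q_i=q_{i-1}\theta_{p_i}$; for $r\le p_k$, $(p_1,\dots,p_k)\rfloor_r=(r_1,\dots,r_k)$ with $r_k=r$, $r_i=r_{i+1}\delta_{p_i}$. These make the path category biordered (with $\mathbf x\le_l\mathbf y\iff \mathbf x={}_{\mathbf d(\mathbf x)}\lfloor\mathbf y$, $\mathbf x\le_r\mathbf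 y\iff\mathbf x=\mathbf y\rfloor_{\mathbf r(\mathbf x)}$). The chain category $\mathcal C(P)$ is its quotient by the congruence generated by $(p,p)\approx(p)$ for $p\in P$; it is biordered with restrictions computed on representatives; its elements are written $[p_1,\dots,p_k]$ and $v\mathcal C(P)=P$. \textbf{Chained projection categories.} An evaluation map for a projection category $(P,\mathcal C)$ is a biordered morphism (functor) $\varepsilon:\mathcal C(P)\to\mathcal C$ with $\varepsilon[p]=p$ for all $p\in P$. For $b\in\mathcal C(q,r)$ and $p,s\in P$ put $e=s\Delta_b\delta_p$, $e_1=s\Delta_b\delta_{p\theta_q}$, $e_2=p\theta_{s\Delta_b}$, $f=p\Theta_b\theta_s$, $f_1=s\delta_{p\Theta_b}$, $f_2=p\Theta_b\theta_{s\delta_r}$; then $e\,\mathscr F\,e_1$, $e\,\mathscr F\,e_2$, $f_1\,\mathscr F\,f$, $f_2\,\mathscr F\,f$ and the following morphisms are defined: $\lambda(p,b,s)=\varepsilon[e,e_1]\circ({}_{p\theta_q}\lfloor b)\rfloor_{f_1}\circ\varepsilon[f_1,f]$ and $\rho(p,b,s)=\varepsilon[e,e_2]\circ{}_{e_2}\lfloor(b\rfloor_{s\delta_r})\circ\varepsilon[f_2,f]$. A chained projection category is a triple $(P,\mathcal C,\varepsilon)$ with $(P,\mathcal C)$ a projection category, $\varepsilon$ an evaluation map, and (C2) $\lambda(p,b,s)=\rho(p,b,s)$ for all $b\in\mathcal C$, $p,s\in P$. A chained projection functor $(P,\mathcal C,\varepsilon)\to(P',\mathcal C',\varepsilon')$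 is a biordered morphism $\phi:\mathcal C\to\mathcal C'$ whose restriction to objects is a projection algebra morphism $P\to P'$ and with $(\varepsilon[p_1,\dots,p_k])\phi=\varepsilon'[p_1\phi,\dots,p_k\phi]$. $\mathbf{CPC}$ is the category of chained projection categories and chained projection functors. *)

(* Defs.v *)
From Stdlib Require Import List Classical ClassicalEpsilon.
Import ListNotations.

Record DRCsg := {
  drc_car :> Type;
  drc_mul : drc_car -> drc_car -> drc_car;
  drc_D : drc_car -> drc_car;
  drc_R : drc_car -> drc_car;
  drc_assoc : forall a b c, drc_mul a (drc_mul b c) = drc_mul (drc_mul a b) c;
  drc_Da : forall a, drc_mul (drc_D a) a = a;
  drc_aR : forall a, drc_mul a (drc_R a) = a;
  drc_Dab : forall a b, drc_D (drc_mul a b) = drc_D (drc_mul a (drc_D b));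
  drc_Rab : forall a b, drc_R (drc_mul a b) = drc_R (drc_mul (drc_R a) b);
  drc_Dab2 : forall a b,
    drc_D (drc_mul a b) = drc_mul (drc_mul (drc_D a) (drc_D (drc_mul a b))) (drc_D a);
  drc_Rab2 : forall a b,
    drc_R (drc_mul a b) = drc_mul (drc_mul (drc_R b) (drc_R (drc_mul a b))) (drc_R b);
  drc_RD : forall a, drc_R (drc_D a) = drc_D a;
  drc_DR : forall a, drc_D (drc_R a) = drc_R a }.
Arguments drc_mul {d} _ _.
Arguments drc_D {d} _.
Arguments drc_R {d} _.

Definition DRC_hom (S T : DRCsg) : Type :=
  { f : S -> T |
      (forall a b, f (drc_mul a b) = drc_mul (f a) (f b)) /\
      (forall a, f (drc_D a) = drc_D (f a)) /\
      (forall a, f (drc_R a) = drc_R (f a)) }.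

(* Projection algebras.  [th p q] stands for q θ_p, [de p q] for q δ_p. *)

Definition is_proj_alg {P : Type} (th de : P -> P -> P) : Prop :=
  (forall p, th p p = p) /\ (forall p, de p p = p) /\
  (forall p q, th (th p q) p = th p q) /\
  (forall p q, de (de p q) p = de p q) /\
  (forall p q x, th (th p q) (th q x) = th p (th q x)) /\
  (forall p q x, de (de p q) (de q x) = de p (de q x)) /\
  (forall p x, de p (th p x) = th p x) /\
  (forall p x, th p (de p x) = de p x) /\
  (forall p q x, th p (th (de q p) x) = th p (th q x)) /\
  (forall p q x, de p (de (th q p) x) = de p (de q x)).

Definition pa_le {P : Type} (th : P -> P -> P) (p q : P) : Prop := p = th q p.

Definition pa_F {P : Type} (th de : P -> P -> P) (p q : P) : Prop :=
  p = de p q /\ q = th q p.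

(* Small categories (morphisms only; objects = identity morphisms)      *)

Record Cat := {
  cM :> Type;
  cd : cM -> cM;
  cr : cM -> cM;
  ccomp : forall a b : cM, cr a = cd b -> cM;
  cat_dd : forall a, cd (cd a) = cd a;
  cat_rd : forall a, cr (cd a) = cd a;
  cat_dr : forall a, cd (cr a) = cr a;
  cat_rr : forall a, cr (cr a) = cr a;
  cat_dcomp : forall a b h, cd (ccomp a b h) = cd a;
  cat_rcomp : forall a b h, cr (ccomp a b h) = cr b;
  cat_idl : forall a h, ccomp (cd a) a h = a;
  cat_idr : forall a h, ccomp a (cr a) h = a;
  cat_assoc : forall a b c (h2 : cr b = cd c) (h1 : cr a = cd (ccomp b c h2))
    (h3 : cr a = cd b) (h4 : cr (ccomp a b h3) = cd c),
    ccomp a (ccomp b c h2) h1 = ccomp (ccomp a b h3) c h4 }.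
Arguments cd {c0} _.
Arguments cr {c0} _.
Arguments ccomp {c0} _ _ _.
Arguments cat_dd {c0} _.
Arguments cat_dr {c0} _.

Definition Ob (C : Cat) : Type := { p : C | cd p = p }.
Definition ob_d {C : Cat} (a : C) : Ob C := exist _ (cd a) (cat_dd a).
Definition ob_r {C : Cat} (a : C) : Ob C := exist _ (cr a) (cat_dr a).

(* total composition (junk value a when not composable) *)
Definition tcomp {C : Cat} (a b : C) : C :=
  match excluded_middle_informative (cr a = cd b) with
  | left h => ccomp a b h
  | right _ => a
  end.

Definition is_porder {A : Type} (le : A -> A -> Prop) : Prop :=
  (forall a, le a a) /\ (forall a b, le a b -> le b a -> a = b) /\
  (forall a b c, le a b -> le b c -> le a c).

Definition left_ordered {C : Cat} (le : C -> C -> Prop) : Prop :=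
  is_porder le /\
  (forall a b, le a b -> le (cd a) (cd b) /\ le (cr a) (cr b)) /\
  (forall a b c c' h h', le a b -> le c c' ->
      le (ccomp a c h) (ccomp b c' h')) /\
  (forall (a p : C), cd p = p -> le p (cd a) ->
      exists! u, le u a /\ cd u = p).

Definition right_ordered {C : Cat} (le : C -> C -> Prop) : Prop :=
  is_porder le /\
  (forall a b, le a b -> le (cd a) (cd b) /\ le (cr a) (cr b)) /\
  (forall a b c c' h h', le a b -> le c c' ->
      le (ccomp a c h) (ccomp b c' h')) /\
  (forall (a q : C), cd q = q -> le q (cr a) ->
      exists! v, le v a /\ cr v = q).

Record BiCat := {
  bc :> Cat;
  lel : bc -> bc -> Prop;
  ler : bc -> bc -> Prop;
  bc_left : left_ordered lel;
  bc_right : right_ordered ler;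
  bc_agree : forall p q : bc, cd p = p -> cd q = q -> (lel p q <-> ler p q) }.
Arguments lel {b} _ _.
Arguments ler {b} _ _.

(* left restriction  _p⌊a  and right restriction  a⌋_q  (meaningful when
   p <= d(a), resp. q <= r(a); junk otherwise) *)
Definition lres {C : BiCat} (p a : C) : C :=
  epsilon (inhabits a) (fun u => lel u a /\ cd u = p).
Definition rres {C : BiCat} (a q : C) : C :=
  epsilon (inhabits a) (fun v => ler v a /\ cr v = q).

Definition Theta {C : BiCat} (th : Ob C -> Ob C -> Ob C) (a : C) (p : Ob C) : Ob C :=
  ob_r (lres (proj1_sig (th (ob_d a) p)) a).
Definition Delta {C : BiCat} (de : Ob C -> Ob C -> Ob C) (a : C) (p : Ob C) : Ob C :=
  ob_d (rres a (proj1_sig (de (ob_r a) p))).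

Record ProjCat := {
  pc :> BiCat;
  pth : Ob pc -> Ob pc -> Ob pc;
  pde : Ob pc -> Ob pc -> Ob pc;
  pc_pa : is_proj_alg pth pde;
  pc_lel : forall p q : Ob pc, lel (proj1_sig p) (proj1_sig q) <-> pa_le pth p q;
  pc_ler : forall p q : Ob pc, ler (proj1_sig p) (proj1_sig q) <-> pa_le pth p q;
  pc_C1 : forall (a : pc) (p q : Ob pc),
    pa_le pth p (ob_d a) -> pa_le pth q (ob_r a) ->
    (forall x, Theta pth (rres a (proj1_sig q)) x = pth q (Theta pth a x)) /\
    (forall x, Delta pde (lres (proj1_sig p) a) x = pde p (Delta pde a x)) }.

Fixpoint fchain {A : Type} (R : A -> A -> Prop) (l : list A) : Prop :=
  match l with
  | [] => True
  | x :: t => match t with [] => True | y :: _ => R x y /\ fchain R t end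
  end.

Definition Path (C : ProjCat) : Type :=
  { l : list (Ob C) | l <> [] /\ fchain (pa_F (@pth C) (@pde C)) l }.

Fixpoint lr_aux {A : Type} (th : A -> A -> A) (x : A) (l : list A) : list A :=
  match l with
  | [] => []
  | p :: t => th p x :: lr_aux th (th p x) t
  end.
Definition path_lres {A : Type} (th : A -> A -> A) (q : A) (l : list A) : list A :=
  match l with [] => [] | _ :: t => q :: lr_aux th q t end.
Definition path_rres {A : Type} (de : A -> A -> A) (r : A) (l : list A) : list A :=
  rev (path_lres de r (rev l)).

(* An evaluation map ε : C(P) -> C is encoded by its composite with the
   quotient map from the path category, i.e. by a map on paths that is a
   biordered functor identifying (p,p) with (p). *)
Definition is_evaluation {C : ProjCat} (eps : Path C -> C) : Prop :=
  (forall (x : Path C) p l, proj1_sig x = p :: l -> cd (eps x) = proj1_sig p) /\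
  (forall (x : Path C) p l, proj1_sig x = l ++ [p] -> cr (eps x) = proj1_sig p) /\
  (forall (x : Path C) p, proj1_sig x = [p] -> eps x = proj1_sig p) /\
  (forall (x : Path C) p, proj1_sig x = [p; p] -> eps x = proj1_sig p) /\
  (forall (x y z : Path C) l1 p l2 h,
      proj1_sig x = l1 ++ [p] -> proj1_sig y = p :: l2 ->
      proj1_sig z = l1 ++ p :: l2 ->
      eps z = ccomp (eps x) (eps y) h) /\
  (forall (y y' : Path C) p l q,
      proj1_sig y = p :: l -> pa_le (@pth C) q p ->
      proj1_sig y' = path_lres (@pth C) q (proj1_sig y) ->
      lel (eps y') (eps y)) /\
  (forall (y y' : Path C) p l r,
      proj1_sig y = l ++ [p] -> pa_le (@pth C) r p ->
      proj1_sig y' = path_rres (@pde C) r (proj1_sig y) ->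
      ler (eps y') (eps y)).

Definition cond_C2 {C : ProjCat} (eps : Path C -> C) : Prop :=
  forall (b : C) (p s : Ob C),
    let th := @pth C in let de := @pde C in
    let q := ob_d b in let r := ob_r b in
    let e := de p (Delta de b s) in
    let e1 := de (th q p) (Delta de b s) in
    let e2 := th (Delta de b s) p in
    let f := th s (Theta th b p) in
    let f1 := de (Theta th b p) s in
    let f2 := th (de r s) (Theta th b p) in
    forall w1 w2 w3 w4 : Path C,
      proj1_sig w1 = [e; e1] -> proj1_sig w2 = [f1; f] ->
      proj1_sig w3 = [e; e2] -> proj1_sig w4 = [f2; f] ->
      tcomp (tcomp (eps w1)
                   (rres (lres (proj1_sig (th q p)) b) (proj1_sig f1)))
            (eps w2)
      = tcomp (tcomp (eps w3)
                     (lres (proj1_sig e2) (rres b (proj1_sig (de r s)))))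
              (eps w4).

Record CPCat := {
  cpc :> ProjCat;
  ceps : Path cpc -> cpc;
  cpc_eval : is_evaluation ceps;
  cpc_C2 : cond_C2 ceps }.
Arguments ceps {c} _.

Definition CPC_hom (C C' : CPCat) : Type :=
  { phi : C -> C' |
      (forall a, cd (phi a) = phi (cd a)) /\
      (forall a, cr (phi a) = phi (cr a)) /\
      (forall (a b : C) h h', phi (ccomp a b h) = ccomp (phi a) (phi b) h') /\
      (forall a b, lel a b -> lel (phi a) (phi b)) /\
      (forall a b, ler a b -> ler (phi a) (phi b)) /\
      (forall (p q : Ob C) (p' q' : Ob C'),
          proj1_sig p' = phi (proj1_sig p) -> proj1_sig q' = phi (proj1_sig q) ->
          proj1_sig (@pth C' p' q') = phi (proj1_sig (@pth C p q)) /\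
          proj1_sig (@pde C' p' q') = phi (proj1_sig (@pde C p q))) /\
      (forall (x : Path C) (x' : Path C'),
          map (@proj1_sig _ _) (proj1_sig x')
            = map (fun p => phi (proj1_sig p)) (proj1_sig x) ->
          ceps x' = phi (ceps x)) }.

(* Main.v *)
(* A DRC-semigroup S becomes a category with domain D, codomain R and the
   restriction of the product to pairs with R(a) = D(b); its orders are
   restriction by projections and its evaluation map multiplies out a path.
   Conversely a chained projection category carries the total product
     a • b = a⌋_p ∘ ε[p, q] ∘ _q⌊b,  p = d(b) δ_(r(a)),  q = r(a) θ_(d(b)).
   By (C1), restricting a • b on the right at c gives
     (a • b) • c = a⌋_e ∘ λ(r(a), b, d(c)) ∘ _f⌊c,
   and dually a • (b • c) = a⌋_e ∘ ρ(r(a), b, d(c)) ∘ _f⌊c, so (C2) is exactly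
   associativity.  The two constructions are mutually inverse because
   D(m) R(m) = m for a product m of two projections, which also makes functors
   between such categories multiplicative. *)
From Stdlib Require Import List ClassicalEpsilon.
From Stdlib Require Import FunctionalExtensionality PropExtensionality ProofIrrelevance.
Require Import Defs.
Import ListNotations.

(** * From DRC-semigroups to chained projection categories *)

Infix "∙" := drc_mul (at level 40, left associativity).

(** The formula for • is read off from a semigroup. With m = R(a)D(b), the projections d(b)δ_(r(a))
    and r(a)θ_(d(b)) are D(m) and R(m), and ab = aD(m) · D(m)R(m) · R(m)b is a product of composable
    factors. Projections need not commute, so m is in general no projection and the middle factor is
    not an identity; the evaluation map is the part of the categorical structure that stores it.

    An isomorphism of categories asks for equal objects, which here means equal records. Both
    constructions therefore keep the carrier, the domain map D and the codomain map R up to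
    conversion. What remains is to compare products, orders, projection operations and evaluation
    maps pointwise; extensionality for functions and propositions together with proof irrelevance
    then gives the equality. For the same reason corresponding morphisms have the same underlying
    map, and fullness amounts to showing that such a map is multiplicative. *)

(** Transparent, so that a lemma taken at [drc_op S] converts to its left-right dual in [S] and
    [exact] accepts it. *)
Definition drc_op (S : DRCsg) : DRCsg.
Proof.
  refine {| drc_car := S; drc_mul := fun a b => b ∙ a;
            drc_D := @drc_R S; drc_R := @drc_D S |}; intros.
  - symmetry; apply drc_assoc.
  - apply drc_aR.
  - apply drc_Da.
  - apply drc_Rab.
  - apply drc_Dab.
  - rewrite drc_assoc; apply drc_Rab2.
  - rewrite drc_assoc; apply drc_Dab2.
  - apply drc_DR.
  - apply drc_RD.
Defined.

(** * Projections of a DRC-semigroup and their order *)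

Lemma drc_DD {S : DRCsg} (a : S) : drc_D (drc_D a) = drc_D a.
Proof. rewrite <- (drc_RD S a) at 1; rewrite drc_DR; apply drc_RD. Qed.

Lemma drc_RR {S : DRCsg} (a : S) : drc_R (drc_R a) = drc_R a.
Proof. exact (@drc_DD (drc_op S) a). Qed.

Lemma proj_R {S : DRCsg} {p : S} : drc_D p = p -> drc_R p = p.
Proof. intros <-; apply drc_RD. Qed.

Lemma proj_idem {S : DRCsg} {p : S} : drc_D p = p -> p ∙ p = p.
Proof. intros Hp; rewrite <- Hp at 1; apply drc_Da. Qed.

Lemma D_idem {S : DRCsg} (a : S) : drc_D a ∙ drc_D a = drc_D a.
Proof. apply proj_idem, drc_DD. Qed.

Lemma D_mul_absorb_l {S : DRCsg} (a b : S) : drc_D a ∙ drc_D (a ∙ b) = drc_D (a ∙ b).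
Proof. rewrite drc_Dab2, !drc_assoc, D_idem; reflexivity. Qed.

Lemma D_mul_absorb_r {S : DRCsg} (a b : S) : drc_D (a ∙ b) ∙ drc_D a = drc_D (a ∙ b).
Proof. rewrite drc_Dab2, <- !drc_assoc, D_idem; reflexivity. Qed.

Lemma R_mul_absorb_l {S : DRCsg} (a b : S) : drc_R b ∙ drc_R (a ∙ b) = drc_R (a ∙ b).
Proof. exact (@D_mul_absorb_r (drc_op S) b a). Qed.

Lemma R_mul_absorb_r {S : DRCsg} (a b : S) : drc_R (a ∙ b) ∙ drc_R b = drc_R (a ∙ b).
Proof. exact (@D_mul_absorb_l (drc_op S) b a). Qed.

(** If p = pq then p = R(pq), and R(pq) is fixed by left multiplication by R(q) = q. With the dual,
    the two one-sided orders on projections coincide although projections need not commute. *)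
Lemma proj_le_swap {S : DRCsg} {p q : S} :
  drc_D p = p -> drc_D q = q -> p = p ∙ q -> p = q ∙ p.
Proof.
  intros Hp Hq H.
  pose proof (R_mul_absorb_l p q) as E.
  rewrite <- H, (proj_R Hp), (proj_R Hq) in E; auto.
Qed.

Lemma proj_le_swap' {S : DRCsg} {p q : S} :
  drc_D p = p -> drc_D q = q -> p = q ∙ p -> p = p ∙ q.
Proof.
  intros Hp Hq. exact (@proj_le_swap (drc_op S) p q (proj_R Hp) (proj_R Hq)).
Qed.

(** Links the projection algebra order p = pθ_q, where pθ_q will be R(pq), to multiplication. *)
Lemma proj_le_R {S : DRCsg} {p q : S} :
  drc_D p = p -> drc_D q = q -> (p = drc_R (p ∙ q) <-> p = q ∙ p).
Proof.
  intros Hp Hq; split; intros H.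
  - rewrite H at 2; rewrite <- (proj_R Hq) at 1; rewrite R_mul_absorb_l; exact H.
  - rewrite <- (proj_le_swap' Hp Hq H); symmetry; exact (proj_R Hp).
Qed.

Lemma R_absorb_proj {S : DRCsg} {q : S} (a : S) : drc_D q = q -> q ∙ drc_R (a ∙ q) = drc_R (a ∙ q).
Proof. intros Hq; rewrite <- (proj_R Hq) at 1; apply R_mul_absorb_l. Qed.

Lemma D_absorb_proj {S : DRCsg} {p : S} (b : S) : drc_D p = p -> drc_D (p ∙ b) ∙ p = drc_D (p ∙ b).
Proof. intros Hp; rewrite <- Hp at 2; apply D_mul_absorb_r. Qed.

(** For m = pq one has D(m) = D(m)p and R(m) = qR(m), so D(m)R(m) = D(m) pq R(m) = D(m) m R(m) =
    m. *)
Lemma D_mul_R {S : DRCsg} {p q : S} :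
  drc_D p = p -> drc_D q = q -> drc_D (p ∙ q) ∙ drc_R (p ∙ q) = p ∙ q.
Proof.
  intros Hp Hq.
  rewrite <- (R_absorb_proj p Hq), <- (D_absorb_proj q Hp).
  rewrite <- (drc_assoc _ _ p), (drc_assoc _ p q), drc_aR. apply drc_Da.
Qed.

Lemma mul_R_mul {S : DRCsg} {p : S} (a : S) : drc_D p = p -> a ∙ drc_R (a ∙ p) = a ∙ p.
Proof.
  intros Hp; rewrite <- (R_absorb_proj a Hp), drc_assoc; apply drc_aR.
Qed.

Lemma D_mul_mul {S : DRCsg} {p : S} (a : S) : drc_D p = p -> drc_D (p ∙ a) ∙ a = p ∙ a.
Proof. intros Hp; exact (@mul_R_mul (drc_op S) p a (proj_R Hp)). Qed.

(** * The biordered category of a DRC-semigroup *)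

Definition drc_cat (S : DRCsg) : Cat.
Proof.
  refine {| cM := S; cd := @drc_D S; cr := @drc_R S; ccomp := fun a b _ => a ∙ b |}; intros.
  - apply drc_DD.
  - apply drc_RD.
  - apply drc_DR.
  - apply drc_RR.
  - rewrite drc_Dab, <- h, drc_aR; reflexivity.
  - rewrite drc_Rab, h, drc_Da; reflexivity.
  - apply drc_Da.
  - apply drc_aR.
  - apply drc_assoc.
Defined.

(** The second equation is D(a) ≤ D(b). The first alone only gives D(a) = D(D(a)D(b)), which is
    weaker when projections do not commute. *)
Definition drc_lel {S : DRCsg} (a b : S) : Prop :=
  a = drc_D a ∙ b /\ drc_D a = drc_D b ∙ drc_D a.
Definition drc_ler {S : DRCsg} (a b : S) : Prop :=
  a = b ∙ drc_R a /\ drc_R a = drc_R a ∙ drc_R b.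

Lemma drc_lel_porder (S : DRCsg) : is_porder (@drc_lel S).
Proof.
  repeat split.
  - symmetry; apply drc_Da.
  - symmetry; apply D_idem.
  - intros a b [Ha Hab] [Hb Hba].
    apply proj_le_swap' in Hab; try apply drc_DD.
    rewrite Hab, <- Hba, drc_Da in Ha; exact Ha.
  - destruct H as [H1 H2], H0 as [H3 H4].
    apply proj_le_swap' in H2; try apply drc_DD.
    rewrite H1 at 1; rewrite H3, drc_assoc, <- H2; reflexivity.
  - destruct H as [H1 H2], H0 as [H3 H4].
    rewrite H2, drc_assoc, <- H4; reflexivity.
Qed.

Lemma drc_left_ordered (S : DRCsg) : left_ordered (C := drc_cat S) drc_lel.
Proof.
  split; [apply drc_lel_porder|]; cbn; unfold drc_lel.
  split; [|split].
  - intros a b [H1 H2]; split; split; rewrite ?drc_DD, ?drc_DR.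
    + apply proj_le_swap'; auto using drc_DD.
    + exact H2.
    + apply proj_le_swap'; auto using drc_DR.
      rewrite H1, R_mul_absorb_l; reflexivity.
    + rewrite H1, R_mul_absorb_l; reflexivity.
  - intros a b c c' h h' [H1 H2] [H3 H4].
    assert (E : drc_D (a ∙ c) = drc_D a) by (rewrite drc_Dab, <- h, drc_aR; reflexivity).
    assert (E' : drc_D (b ∙ c') = drc_D b) by (rewrite drc_Dab, <- h', drc_aR; reflexivity).
    rewrite E, E'; split; [|exact H2].
    rewrite H3, <- h, drc_assoc, drc_aR, drc_assoc, <- H1; reflexivity.
  - intros a p Hp [H1 H2]; rewrite Hp, drc_DD in H2.
    exists (p ∙ a).
    assert (E : drc_D (p ∙ a) = p).
    { rewrite drc_Dab, <- (proj_le_swap' Hp (drc_DD a) H2); exact Hp. }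
    repeat split; rewrite ?E; auto.
    intros u [[H3 _] H4]; rewrite <- H4; auto.
Qed.

Lemma drc_right_ordered (S : DRCsg) : right_ordered (C := drc_cat S) drc_ler.
Proof.
  destruct (drc_left_ordered (drc_op S)) as (H1 & H2 & H3 & H4).
  split; [exact H1|split; [|split]]; cbn in *.
  - intros a b H; apply H2 in H as [A B].
    exact (conj B A).
  - intros a b c c' h h' Hab Hcc.
    exact (H3 c c' a b (eq_sym h) (eq_sym h') Hcc Hab).
  - intros a q Hq Hle; apply (H4 a q); [exact (proj_R Hq)|].
    revert Hle; unfold drc_ler, drc_lel; cbn.
    rewrite (proj_R Hq); auto.
Qed.

Definition drc_bicat (S : DRCsg) : BiCat.
Proof.
  refine {| bc := drc_cat S; lel := drc_lel; ler := drc_ler;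
            bc_left := drc_left_ordered S; bc_right := drc_right_ordered S |}.
  cbn; intros p q Hp Hq; unfold drc_lel, drc_ler.
  rewrite Hp, Hq, (proj_R Hp), (proj_R Hq).
  pose proof (proj_le_swap Hp Hq); pose proof (proj_le_swap' Hp Hq); tauto.
Defined.

(** Whatever u the [epsilon] selects, u ≤_l a and D(u) = p force u = D(u)a = pa. *)
Lemma drc_lres {S : DRCsg} (p a : S) :
  drc_D p = p -> p = drc_D a ∙ p -> lres (C := drc_bicat S) p a = p ∙ a.
Proof.
  intros Hp H; unfold lres.
  assert (E : drc_D (p ∙ a) = p).
  { rewrite drc_Dab, <- (proj_le_swap' Hp (drc_DD a) H); exact Hp. }
  match goal with |- epsilon ?i ?Q = _ =>
    assert (Hex : exists u, Q u)
      by (exists (p ∙ a); cbn; unfold drc_lel; rewrite E; auto);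
    destruct (epsilon_spec i Q Hex) as [[H1 _] H2] end.
  cbn in *; rewrite H2 in H1; exact H1.
Qed.

Lemma drc_rres {S : DRCsg} (q a : S) :
  drc_D q = q -> q = q ∙ drc_R a -> rres (C := drc_bicat S) a q = a ∙ q.
Proof.
  intros Hq H; exact (@drc_lres (drc_op S) q a (proj_R Hq) H).
Qed.

Lemma Ob_eq {C : Cat} (p q : Ob C) : proj1_sig p = proj1_sig q -> p = q.
Proof.
  destruct p as [p hp], q as [q hq]; cbn; intros <-.
  f_equal; apply proof_irrelevance.
Qed.

(** * The projection algebra and condition (C1) *)

Definition drc_th {S : DRCsg} (p q : Ob (drc_cat S)) : Ob (drc_cat S) :=
  exist _ (drc_R (proj1_sig q ∙ proj1_sig p)) (drc_DR S _).
Definition drc_de {S : DRCsg} (p q : Ob (drc_cat S)) : Ob (drc_cat S) :=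
  exist _ (drc_D (proj1_sig p ∙ proj1_sig q)) (drc_DD _).

Lemma Ob_proj {S : DRCsg} (p : Ob (drc_cat S)) : drc_D (proj1_sig p) = proj1_sig p.
Proof. exact (proj2_sig p). Qed.

(* The axioms on [th] alone and the mixed ones, at the level of elements; the
   rest is dual. *)
Lemma proj_alg_half {S : DRCsg} (p q x : S) :
  drc_D p = p -> drc_D q = q ->
  drc_R (p ∙ p) = p /\ drc_R (p ∙ drc_R (q ∙ p)) = drc_R (q ∙ p) /\
  drc_R (drc_R (x ∙ q) ∙ drc_R (q ∙ p)) = drc_R (drc_R (x ∙ q) ∙ p) /\
  drc_D (p ∙ drc_R (x ∙ p)) = drc_R (x ∙ p) /\
  drc_R (drc_R (x ∙ drc_D (q ∙ p)) ∙ p) = drc_R (drc_R (x ∙ q) ∙ p).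
Proof.
  intros Hp Hq; repeat split.
  - rewrite (proj_idem Hp); exact (proj_R Hp).
  - rewrite (R_absorb_proj q Hp); apply drc_RR.
  - rewrite <- !drc_Rab, <- drc_assoc, (mul_R_mul q Hp), drc_assoc; reflexivity.
  - rewrite (R_absorb_proj x Hp); apply drc_DR.
  - rewrite <- !drc_Rab, <- !drc_assoc, (D_mul_mul p Hq); reflexivity.
Qed.

Lemma drc_proj_alg (S : DRCsg) : is_proj_alg (@drc_th S) (@drc_de S).
Proof.
  (* The holes are filled by the types of the proof terms: the identities of [proj_alg_half] in [S]
     and in its opposite. *)
  assert (H1 : forall p q x : Ob (drc_cat S), _) by (intros p q x;
    exact (proj_alg_half (proj1_sig p) (proj1_sig q) (proj1_sig x) (Ob_proj p) (Ob_proj q))).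
  assert (H2 : forall p q x : Ob (drc_cat S), _) by (intros p q x;
    exact (@proj_alg_half (drc_op S) (proj1_sig p) (proj1_sig q) (proj1_sig x)
       (proj_R (Ob_proj p)) (proj_R (Ob_proj q)))).
  cbn in H2.
  repeat split; intros; apply Ob_eq; cbn;
    first [apply (H1 p p p) | apply (H2 p p p) | apply (H1 p q p) | apply (H2 p q p)
          | apply (H1 p q x) | apply (H2 p q x) | apply (H1 p p x) | apply (H2 p p x)].
Qed.

Lemma drc_pa_le {S : DRCsg} (p q : Ob (drc_cat S)) :
  pa_le drc_th p q <-> proj1_sig p = proj1_sig q ∙ proj1_sig p.
Proof.
  rewrite <- (proj_le_R (Ob_proj p) (Ob_proj q)); unfold pa_le; split; intros H.
  - rewrite H at 1; reflexivity.
  - apply Ob_eq; exact H.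
Qed.

Lemma drc_Theta {S : DRCsg} (a : S) (p : Ob (drc_cat S)) :
  proj1_sig (Theta (C := drc_bicat S) drc_th a p) = drc_R (proj1_sig p ∙ a).
Proof.
  cbn; rewrite drc_lres; cbn; auto using drc_DR.
  - rewrite <- drc_Rab, <- drc_assoc, drc_Da; reflexivity.
  - rewrite <- (drc_RD S a) at 2; rewrite R_mul_absorb_l; reflexivity.
Qed.

Lemma drc_Delta {S : DRCsg} (a : S) (p : Ob (drc_cat S)) :
  proj1_sig (Delta (C := drc_bicat S) drc_de a p) = drc_D (a ∙ proj1_sig p).
Proof.
  cbn; rewrite drc_rres; cbn; auto using drc_DD.
  - rewrite drc_Dab, drc_DD, <- drc_Dab, drc_assoc, drc_aR; reflexivity.
  - rewrite <- (drc_DR S a) at 3; rewrite D_mul_absorb_r; reflexivity.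
Qed.

(** By [drc_Theta], Θ_a is x ↦ R(xa), so (C1) for Θ becomes R(xaq) = R(R(xa)q), an instance of the
    axiom for R of a product. *)
Lemma drc_C1_Theta {S : DRCsg} (a : S) (q x : Ob (drc_cat S)) :
  pa_le drc_th q (ob_r (C := drc_cat S) a) ->
  Theta (C := drc_bicat S) drc_th (rres (C := drc_bicat S) a (proj1_sig q)) x
  = drc_th q (Theta (C := drc_bicat S) drc_th a x).
Proof.
  intros Hq; apply drc_pa_le in Hq; apply Ob_eq.
  etransitivity; [apply drc_Theta|]; rewrite drc_rres.
  - pose proof (drc_Theta a x) as E; cbn in E |- *; rewrite E, <- drc_Rab, drc_assoc; reflexivity.
  - apply Ob_proj.
  - apply (proj_le_swap' (Ob_proj q) (drc_DR S a) Hq).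
Qed.

Lemma drc_C1_Delta {S : DRCsg} (a : S) (p x : Ob (drc_cat S)) :
  pa_le drc_th p (ob_d (C := drc_cat S) a) ->
  Delta (C := drc_bicat S) drc_de (lres (C := drc_bicat S) (proj1_sig p) a) x
  = drc_de p (Delta (C := drc_bicat S) drc_de a x).
Proof.
  intros Hp; apply drc_pa_le in Hp; apply Ob_eq.
  etransitivity; [apply drc_Delta|]; rewrite drc_lres.
  - pose proof (drc_Delta a x) as E; cbn in E |- *; rewrite E, <- drc_Dab, drc_assoc; reflexivity.
  - apply Ob_proj.
  - exact Hp.
Qed.

Definition drc_projcat (S : DRCsg) : ProjCat.
Proof.
  refine {| pc := drc_bicat S; pth := drc_th; pde := drc_de; pc_pa := drc_proj_alg S |};
    cbn.
  - intros p q; rewrite drc_pa_le; destruct p as [p Hp], q as [q Hq]; cbn in *.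
    unfold drc_lel; rewrite Hp, Hq.
    pose proof (proj_le_swap' Hp Hq); tauto.
  - intros p q; rewrite drc_pa_le; destruct p as [p Hp], q as [q Hq]; cbn in *.
    unfold drc_ler; rewrite (proj_R Hp), (proj_R Hq).
    pose proof (proj_le_swap Hp Hq); pose proof (proj_le_swap' Hp Hq); tauto.
  - intros a p q Hp Hq; split; intros x; [apply drc_C1_Theta | apply drc_C1_Delta]; assumption.
Defined.

(** * The evaluation map: multiplying along a path *)

Fixpoint lprod {S : DRCsg} (p : Ob (drc_cat S)) (l : list (Ob (drc_cat S))) : S :=
  match l with
  | [] => proj1_sig p
  | q :: t => proj1_sig p ∙ lprod q t
  end.

(** Takes a path in reversed order, last vertex first: [path_rres] restricts the reversed list, and
    along it right restriction is a structural recursion. *)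
Fixpoint rprod {S : DRCsg} (p : Ob (drc_cat S)) (l : list (Ob (drc_cat S))) : S :=
  match l with
  | [] => proj1_sig p
  | q :: t => rprod q t ∙ proj1_sig p
  end.

Lemma Ob_idem {S : DRCsg} (p : Ob (drc_cat S)) : proj1_sig p ∙ proj1_sig p = proj1_sig p.
Proof. exact (proj_idem (Ob_proj p)). Qed.

Lemma lprod_absorb {S : DRCsg} (p : Ob (drc_cat S)) l : proj1_sig p ∙ lprod p l = lprod p l.
Proof. destruct l; cbn [lprod rprod lr_aux app]; rewrite ?drc_assoc, Ob_idem; reflexivity. Qed.

Lemma rprod_absorb {S : DRCsg} (p : Ob (drc_cat S)) l : rprod p l ∙ proj1_sig p = rprod p l.
Proof. destruct l; cbn [lprod rprod lr_aux app]; rewrite <- ?drc_assoc, Ob_idem; reflexivity. Qed.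

Lemma lprod_app {S : DRCsg} (p q : Ob (drc_cat S)) t l :
  lprod p (t ++ q :: l) = lprod p (t ++ [q]) ∙ lprod q l.
Proof.
  revert p; induction t as [|r t IH]; intros p; cbn [lprod rprod lr_aux app].
  - rewrite <- drc_assoc, lprod_absorb; reflexivity.
  - rewrite IH, drc_assoc; reflexivity.
Qed.

Lemma lprod_snoc {S : DRCsg} (p q : Ob (drc_cat S)) t :
  lprod p (t ++ [q]) = lprod p t ∙ proj1_sig q.
Proof.
  revert p; induction t as [|r t IH]; intros p; cbn [lprod rprod lr_aux app]; [reflexivity|].
  rewrite IH, drc_assoc; reflexivity.
Qed.

Lemma lprod_rev {S : DRCsg} (p q : Ob (drc_cat S)) l u :
  rev (p :: l) = q :: u -> lprod q u = rprod p l.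
Proof.
  revert p q u; induction l as [|r l IH]; intros p q u H.
  - injection H as <- <-; reflexivity.
  - cbn [rev] in H; destruct (rev l ++ [r]) as [|q' u'] eqn:E.
    + destruct (rev l); discriminate.
    + injection H as <- <-; rewrite lprod_snoc, (IH r q' u' E); reflexivity.
Qed.

(** Each new vertex is q' = R(qr), and q q' = q R(qr) = qr; so the restricted vertices can be traded
    for the original ones, one at a time, behind a single leading q. *)
Lemma lprod_lres {S : DRCsg} (p q : Ob (drc_cat S)) t :
  proj1_sig q = proj1_sig q ∙ proj1_sig p ->
  lprod q (lr_aux drc_th q t) = proj1_sig q ∙ lprod p t.
Proof.
  revert p q; induction t as [|r t IH]; intros p q H; cbn [lprod rprod lr_aux app]; [exact H|].
  rewrite (IH r).
  - change (proj1_sig (drc_th r q)) with (drc_R (proj1_sig q ∙ proj1_sig r)).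
    rewrite !drc_assoc, <- H, (mul_R_mul _ (Ob_proj r)), <- drc_assoc, lprod_absorb.
    reflexivity.
  - change (proj1_sig (drc_th r q)) with (drc_R (proj1_sig q ∙ proj1_sig r)).
    rewrite <- (proj_R (Ob_proj r)) at 3; rewrite R_mul_absorb_r; reflexivity.
Qed.

Lemma rprod_rres {S : DRCsg} (p q : Ob (drc_cat S)) t :
  proj1_sig q = proj1_sig p ∙ proj1_sig q ->
  rprod q (lr_aux drc_de q t) = rprod p t ∙ proj1_sig q.
Proof.
  revert p q; induction t as [|r t IH]; intros p q H; cbn [lprod rprod lr_aux app]; [exact H|].
  rewrite (IH r).
  - change (proj1_sig (drc_de r q)) with (drc_D (proj1_sig r ∙ proj1_sig q)).
    rewrite <- !drc_assoc, <- H, (D_mul_mul _ (Ob_proj r)), drc_assoc, rprod_absorb.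
    reflexivity.
  - change (proj1_sig (drc_de r q)) with (drc_D (proj1_sig r ∙ proj1_sig q)).
    rewrite <- (Ob_proj r) at 2; rewrite D_mul_absorb_l; reflexivity.
Qed.

(** If w is the product from q on, then D(pw) = D(pD(w)) = D(pq), and this is p by the first half of
    p ℱ q. *)
Lemma D_lprod {S : DRCsg} (p : Ob (drc_cat S)) t :
  fchain (pa_F drc_th drc_de) (p :: t) -> drc_D (lprod p t) = proj1_sig p.
Proof.
  revert p; induction t as [|q t IH]; intros p H; [apply Ob_proj|].
  destruct H as [[H _] Ht]; cbn [lprod]; rewrite drc_Dab, (IH q Ht).
  rewrite H at 2; reflexivity.
Qed.

Lemma last_cons {A : Type} (p q : A) t : last (q :: t) p = last t q.
Proof.
  revert p q; induction t as [|r t IH]; intros p q; [reflexivity|].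
  change (last (r :: t) p = last (r :: t) q); rewrite !IH; reflexivity.
Qed.

Lemma R_lprod {S : DRCsg} (p : Ob (drc_cat S)) t :
  fchain (pa_F drc_th drc_de) (p :: t) -> drc_R (lprod p t) = proj1_sig (last t p).
Proof.
  revert p; induction t as [|q t IH]; intros p H; [apply (proj_R (Ob_proj p))|].
  destruct H as [[_ H] Ht].
  rewrite last_cons.
  cbn [lprod]; rewrite <- (IH q Ht), <- (lprod_absorb q t), drc_assoc, drc_Rab.
  apply (f_equal (@proj1_sig _ _)) in H.
  change (proj1_sig q = drc_R (proj1_sig p ∙ proj1_sig q)) in H.
  rewrite <- H; reflexivity.
Qed.

Definition path_prod {S : DRCsg} (x : Path (drc_projcat S)) : S :=
  match proj1_sig x as l return l <> [] -> S with
  | [] => fun h => False_rect _ (h eq_refl)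
  | p :: t => fun _ => lprod p t
  end (proj1 (proj2_sig x)).

Lemma path_prodE {S : DRCsg} (x : Path (drc_projcat S)) p t :
  proj1_sig x = p :: t -> path_prod x = lprod p t.
Proof. destruct x as [l h]; cbn; intros ->; reflexivity. Qed.

Lemma path_prod_revE {S : DRCsg} (x : Path (drc_projcat S)) p t :
  proj1_sig x = rev (p :: t) -> path_prod x = rprod p t.
Proof.
  intros H; destruct (proj1_sig x) as [|q u] eqn:E.
  - destruct (proj1 (proj2_sig x) E).
  - rewrite (path_prodE x _ _ E); apply lprod_rev; symmetry; exact H.
Qed.

Lemma path_chain {C : ProjCat} (x : Path C) l :
  proj1_sig x = l -> fchain (pa_F (@pth C) (@pde C)) l.
Proof. intros <-; apply (proj2_sig x). Qed.

Lemma path_prod_R {S : DRCsg} (x : Path (drc_projcat S)) p l :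
  proj1_sig x = l ++ [p] -> drc_R (path_prod x) = proj1_sig p.
Proof.
  intros H; destruct l as [|q l]; rewrite (path_prodE x _ _ H).
  - exact (proj_R (Ob_proj p)).
  - etransitivity; [apply R_lprod, (path_chain x _ H)|].
    rewrite last_last; reflexivity.
Qed.

Lemma path_prod_evaluation (S : DRCsg) : is_evaluation (@path_prod S).
Proof.
  repeat apply conj.
  - intros x p l H; rewrite (path_prodE x _ _ H); apply D_lprod, (path_chain x _ H).
  - exact path_prod_R.
  - intros x p H; rewrite (path_prodE x _ _ H); reflexivity.
  - intros x p H; rewrite (path_prodE x _ _ H); apply Ob_idem.
  - intros x y z l1 p l2 h Hx Hy Hz.
    change (path_prod z = path_prod x ∙ path_prod y); clear h.
    destruct l1 as [|q l1]; cbn [app] in *;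
      rewrite (path_prodE x _ _ Hx), (path_prodE y _ _ Hy), (path_prodE z _ _ Hz).
    + symmetry; apply lprod_absorb.
    + apply lprod_app.
  - intros y y' p l q Hy Hq Hy'; rewrite Hy in Hy'.
    rewrite (path_prodE _ _ _ Hy), (path_prodE _ _ _ Hy').
    apply drc_pa_le in Hq; pose proof (proj_le_swap' (Ob_proj q) (Ob_proj p) Hq) as Hq'.
    split; cbn.
    + etransitivity; [apply (lprod_lres p q l Hq')|].
      f_equal; symmetry; apply D_lprod, (path_chain y' _ Hy').
    + pose proof (D_lprod _ _ (path_chain y _ Hy)) as E.
      pose proof (D_lprod _ _ (path_chain y' _ Hy')) as E'.
      cbn in *; rewrite E, E'; exact Hq.
  - intros y y' p l r Hy Hr Hy'; unfold path_rres in Hy'.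
    rewrite Hy, rev_app_distr in Hy'; cbn [rev app path_lres] in Hy'.
    assert (Hy1 : proj1_sig y = rev (p :: rev l))
      by (cbn [rev]; rewrite rev_involutive; exact Hy).
    rewrite (path_prod_revE _ _ _ Hy1), (path_prod_revE _ _ _ Hy').
    apply drc_pa_le in Hr; pose proof (proj_le_swap' (Ob_proj r) (Ob_proj p) Hr) as Hr'.
    assert (Ey : drc_R (path_prod y) = proj1_sig p) by exact (path_prod_R y p l Hy).
    assert (Ey' : drc_R (path_prod y') = proj1_sig r).
    { eapply path_prod_R; exact Hy'. }
    rewrite (path_prod_revE _ _ _ Hy1) in Ey; rewrite (path_prod_revE _ _ _ Hy') in Ey'.
    split; cbn.
    + etransitivity; [apply (rprod_rres p r _ Hr)|].
      f_equal; symmetry; exact Ey'.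
    + cbn in *; rewrite Ey, Ey'; exact Hr'.
Qed.

(** * Condition (C2) in a DRC-semigroup *)

Lemma drc_tcomp {S : DRCsg} (a b : S) :
  drc_R a = drc_D b -> tcomp (C := drc_cat S) a b = a ∙ b.
Proof.
  intros H; unfold tcomp; destruct (excluded_middle_informative _) as [|n];
    [reflexivity|destruct (n H)].
Qed.

Lemma R_restrict_mul {S : DRCsg} (p b : S) : drc_R (drc_R (p ∙ drc_D b) ∙ b) = drc_R (p ∙ b).
Proof. rewrite <- drc_Rab, <- drc_assoc, drc_Da; reflexivity. Qed.

(** This lemma and the next two are what it takes for the restrictions and composites in λ(p, b, s)
    to be defined; taken at [drc_op S] they serve ρ. *)
Lemma lambda_rres_le {S : DRCsg} (p b s : S) :
  let f1 := drc_D (drc_R (p ∙ b) ∙ s) in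
  f1 = f1 ∙ drc_R (drc_R (p ∙ drc_D b) ∙ b).
Proof.
  cbn; rewrite R_restrict_mul; symmetry; apply D_absorb_proj, drc_DR.
Qed.

Lemma lambda_D {S : DRCsg} (p b s : S) :
  let q1 := drc_R (p ∙ drc_D b) in
  drc_D (q1 ∙ b ∙ drc_D (drc_R (p ∙ b) ∙ s)) = drc_D (q1 ∙ drc_D (b ∙ s)).
Proof.
  cbn; rewrite <- !drc_Dab, <- (R_restrict_mul p b), !drc_assoc, drc_aR; reflexivity.
Qed.

Lemma lambda_R {S : DRCsg} (p b s : S) :
  let f1 := drc_D (drc_R (p ∙ b) ∙ s) in
  drc_R (drc_R (p ∙ drc_D b) ∙ b ∙ f1) = f1.
Proof.
  cbn; rewrite drc_Rab, R_restrict_mul.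
  pose proof (D_mul_absorb_l (drc_R (p ∙ b)) s) as E; rewrite drc_DR in E.
  rewrite E; apply drc_RD.
Qed.

(** The left side is λ(p, b, s) multiplied out. Its right end is f1 f = R(pb)s, and q1 b R(pb) = q1
    b, which leaves q1 b s. Since t fixes bs on the left, D(q1 t) is absorbed; then D(pt) = D(pt)p
    releases a factor p, and p q1 bs reduces to pt bs, on which D(pt) acts trivially. *)
Lemma lambda_value {S : DRCsg} (p b s : S) :
  drc_D p = p -> drc_D s = s ->
  let q1 := drc_R (p ∙ drc_D b) in
  let t := drc_D (b ∙ s) in
  let f1 := drc_D (drc_R (p ∙ b) ∙ s) in
  drc_D (p ∙ t) ∙ drc_D (q1 ∙ t) ∙ (q1 ∙ b ∙ f1) ∙ (f1 ∙ drc_R (drc_R (p ∙ b) ∙ s))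
  = p ∙ b ∙ s.
Proof.
  intros Hp Hs q1 t f1.
  assert (Ef : f1 ∙ (f1 ∙ drc_R (drc_R (p ∙ b) ∙ s)) = drc_R (p ∙ b) ∙ s).
  { unfold f1; rewrite drc_assoc, D_idem; apply D_mul_R; [apply drc_DR|exact Hs]. }
  assert (Eb : q1 ∙ b ∙ (drc_R (p ∙ b) ∙ s) = q1 ∙ (b ∙ s)).
  { unfold q1; rewrite <- (R_restrict_mul p b), !drc_assoc, drc_aR; reflexivity. }
  assert (Et : t ∙ (b ∙ s) = b ∙ s) by apply drc_Da.
  assert (Eq : drc_D b ∙ t = t) by apply D_mul_absorb_l.
  assert (E1 : p ∙ drc_D b ∙ q1 = p ∙ drc_D b) by apply drc_aR.
  assert (E2 : drc_D b ∙ q1 = q1) by (apply R_absorb_proj, drc_DD).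
  rewrite <- !drc_assoc, (drc_assoc _ b f1), (drc_assoc _ q1), (drc_assoc _ q1),
   <- (drc_assoc _ (q1 ∙ b) f1), Ef, Eb.
  rewrite <- Et at 1; rewrite (drc_assoc _ q1 t), (drc_assoc _ (drc_D (q1 ∙ t))), drc_Da.
  rewrite <- (drc_assoc _ q1 t), Et.
  transitivity (drc_D (p ∙ t) ∙ p ∙ (q1 ∙ (b ∙ s))).
  { unfold t; rewrite D_absorb_proj; auto. }
  (* Inserting D(b) removes q1: p q1 = p D(b) q1 = p D(b), because q1 = R(pD(b)) lies below D(b). *)
  transitivity (drc_D (p ∙ t) ∙ (p ∙ drc_D b) ∙ (b ∙ s)).
  { rewrite <- E1, <- (drc_assoc _ p), E2, !drc_assoc; reflexivity. }
  assert (Ept : p ∙ drc_D b ∙ (b ∙ s) = p ∙ t ∙ (b ∙ s)).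
  { rewrite <- Et, (drc_assoc _ _ t), <- (drc_assoc _ p _ t), Eq, <- !drc_assoc, Et, Et.
    reflexivity. }
  rewrite <- (drc_assoc _ _ _ (b ∙ s)), Ept, drc_assoc, drc_Da, <- !drc_assoc, Et.
  reflexivity.
Qed.

Lemma drc_path2 {S : DRCsg} (x : Path (drc_projcat S)) p q :
  proj1_sig x = [p; q] -> path_prod x = proj1_sig p ∙ proj1_sig q.
Proof. exact (path_prodE x p [q]). Qed.

Lemma drc_path2_R {S : DRCsg} (x : Path (drc_projcat S)) p q :
  proj1_sig x = [p; q] -> drc_R (path_prod x) = proj1_sig q.
Proof. exact (path_prod_R x q [p]). Qed.

Lemma drc_path2_D {S : DRCsg} (x : Path (drc_projcat S)) p q :
  proj1_sig x = [p; q] -> drc_D (path_prod x) = proj1_sig p.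
Proof. intros H; rewrite (path_prodE x _ _ H); exact (D_lprod p [q] (path_chain x _ H)). Qed.

Lemma drc_tcomp3 {S : DRCsg} (a x c : S) : drc_R a = drc_D x -> drc_R x = drc_D c ->
  tcomp (C := drc_cat S) (tcomp (C := drc_cat S) a x) c = a ∙ x ∙ c.
Proof.
  intros H1 H2; rewrite (drc_tcomp a x H1); apply drc_tcomp.
  rewrite drc_Rab, H1, drc_Da; exact H2.
Qed.

Lemma drc_C2 (S : DRCsg) : cond_C2 (@path_prod S).
Proof.
  intros b p s th de q r e e1 e2 f f1 f2 w1 w2 w3 w4 H1 H2 H3 H4.
  pose proof (Ob_proj p) as Pp; pose proof (Ob_proj s) as Ps.
  pose proof (drc_Delta b s) as ED; pose proof (drc_Theta b p) as ET.
  assert (Ee : proj1_sig e = drc_D (proj1_sig p ∙ drc_D (b ∙ proj1_sig s)))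
    by exact (f_equal (fun x => drc_D (proj1_sig p ∙ x)) ED).
  assert (Ee1 : proj1_sig e1
    = drc_D (drc_R (proj1_sig p ∙ drc_D b) ∙ drc_D (b ∙ proj1_sig s)))
    by exact (f_equal (fun x => drc_D (drc_R (proj1_sig p ∙ drc_D b) ∙ x)) ED).
  assert (Ee2 : proj1_sig e2 = drc_R (proj1_sig p ∙ drc_D (b ∙ proj1_sig s)))
    by exact (f_equal (fun x => drc_R (proj1_sig p ∙ x)) ED).
  assert (Ef : proj1_sig f = drc_R (drc_R (proj1_sig p ∙ b) ∙ proj1_sig s))
    by exact (f_equal (fun x => drc_R (x ∙ proj1_sig s)) ET).
  assert (Ef1 : proj1_sig f1 = drc_D (drc_R (proj1_sig p ∙ b) ∙ proj1_sig s))
    by exact (f_equal (fun x => drc_D (x ∙ proj1_sig s)) ET).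
  assert (Ef2 : proj1_sig f2
    = drc_R (drc_R (proj1_sig p ∙ b) ∙ drc_D (drc_R b ∙ proj1_sig s)))
    by exact (f_equal (fun x => drc_R (x ∙ drc_D (drc_R b ∙ proj1_sig s))) ET).
  assert (Eq : proj1_sig (th q p) = drc_R (proj1_sig p ∙ drc_D b)) by reflexivity.
  assert (Er : proj1_sig (de r s) = drc_D (drc_R b ∙ proj1_sig s)) by reflexivity.
  pose proof (drc_path2 _ _ _ H1) as V1; pose proof (drc_path2 _ _ _ H2) as V2.
  pose proof (drc_path2 _ _ _ H3) as V3; pose proof (drc_path2 _ _ _ H4) as V4.
  pose proof (drc_path2_R _ _ _ H1) as R1; pose proof (drc_path2_D _ _ _ H2) as D2.
  pose proof (drc_path2_R _ _ _ H3) as R3; pose proof (drc_path2_D _ _ _ H4) as D4.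
  (* From here on the six objects are known only through their underlying elements, so that they can
     be destructed and substituted. *)
  rewrite Eq, Er; clearbody e e1 e2 f f1 f2.
  clear H1 H2 H3 H4 Eq Er ED ET th de q r.
  destruct p as [p hp], s as [s hs], e as [e he], e1 as [e1 he1], e2 as [e2 he2],
    f as [f hf], f1 as [f1 hf1], f2 as [f2 hf2]; cbn [proj1_sig] in *.
  subst e e1 e2 f f1 f2; cbn [pc drc_projcat].
  transitivity (p ∙ b ∙ s).
  - etransitivity; [|exact (lambda_value p b s Pp Ps)].
    rewrite drc_lres, drc_rres.
    + etransitivity; [apply drc_tcomp3|rewrite V1, V2; reflexivity].
      * rewrite R1; symmetry; apply lambda_D.
      * rewrite D2; apply lambda_R.
    + apply drc_DD.
    + apply lambda_rres_le.
    + apply drc_DR.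
    + symmetry; apply R_absorb_proj, drc_DD.
  (* Up to bracketing, ρ(p, b, s) is λ(s, b, p) in the opposite semigroup, where the value s b p is
     again pbs. *)
  - symmetry; etransitivity; [|rewrite <- drc_assoc;
      exact (@lambda_value (drc_op S) s b p (proj_R Ps) (proj_R Pp))].
    cbn [drc_op drc_mul drc_D drc_R].
    rewrite drc_rres, drc_lres.
    + etransitivity; [apply drc_tcomp3|rewrite V3, V4, !drc_assoc].
      * rewrite R3; symmetry; exact (@lambda_R (drc_op S) s b p).
      * rewrite D4; exact (@lambda_D (drc_op S) s b p).
      * reflexivity.
    + apply drc_DR.
    + apply (@lambda_rres_le (drc_op S)).
    + apply drc_DD.
    + symmetry; apply D_absorb_proj, drc_DR.
Qed.

Definition drc_cpc (S : DRCsg) : CPCat :=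
  {| cpc := drc_projcat S; ceps := @path_prod S;
     cpc_eval := path_prod_evaluation S; cpc_C2 := drc_C2 S |}.

(** * DRC-morphisms as chained projection functors *)

Lemma lprod_morph {S T : DRCsg} (f : DRC_hom S T)
    (p : Ob (drc_cat S)) (t : list (Ob (drc_cat S)))
    (p' : Ob (drc_cat T)) (t' : list (Ob (drc_cat T))) :
  map (@proj1_sig _ _) (p' :: t') = map (fun x => proj1_sig f (proj1_sig x)) (p :: t) ->
  @lprod T p' t' = proj1_sig f (@lprod S p t).
Proof.
  destruct f as [f [Hm Hf]]; cbn [proj1_sig].
  revert p p' t'; induction t as [|q t IH]; intros p p' [|q' t'] H;
    try discriminate; cbn [lprod].
  - injection H as H; exact H.
  - injection H as H1 H2 H3.
    rewrite Hm; apply f_equal2; [exact H1|apply IH; cbn; congruence].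
Qed.

Definition cpc_hom_of {S T : DRCsg} (f : DRC_hom S T) : CPC_hom (drc_cpc S) (drc_cpc T).
Proof.
  exists (proj1_sig f); pose proof (@lprod_morph S T f) as Hl.
  destruct f as [f [Hm [HD HR]]]; cbn [proj1_sig] in *.
  repeat apply conj.
  - intros a; symmetry; apply HD.
  - intros a; symmetry; apply HR.
  - intros a b h h'; apply Hm.
  - intros a b [H1 H2]; split; cbn in *; rewrite <- !HD, <- Hm; congruence.
  - intros a b [H1 H2]; split; cbn in *; rewrite <- !HR, <- Hm; congruence.
  - intros p q p' q' Hp Hq; cbn in *; rewrite HD, HR, !Hm, Hp, Hq; auto.
  - intros x x' H.
    destruct (proj1_sig x) as [|p t] eqn:Ex; [destruct (proj1 (proj2_sig x) Ex)|].
    destruct (proj1_sig x') as [|p' t'] eqn:Ex'; [destruct (proj1 (proj2_sig x') Ex')|].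
    change (path_prod x' = f (path_prod x)).
    rewrite (path_prodE _ _ _ Ex), (path_prodE _ _ _ Ex'); apply Hl; exact H.
Defined.

Definition path2 {C : ProjCat} (p q : Ob C) (h : pa_F (@pth C) (@pde C) p q) : Path C :=
  exist _ [p; q] (conj (fun H => nil_cons (eq_sym H)) (conj h I)).

(** * Projection algebras *)

Lemma pa_dual {P : Type} {th de : P -> P -> P} : is_proj_alg th de -> is_proj_alg de th.
Proof. unfold is_proj_alg; intuition. Qed.

Lemma pa_le_dual {P : Type} {th de : P -> P -> P} : is_proj_alg th de ->
  forall p q, pa_le th p q <-> pa_le de p q.
Proof.
  intros (T1 & D1 & T2 & D2 & T3 & D3 & TD & DT & T4 & D4) p q.
  unfold pa_le; split; intros H; rewrite H at 1.
  - rewrite <- TD, <- H; reflexivity.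
  - rewrite <- DT, <- H; reflexivity.
Qed.

Lemma pa_F_dual {P : Type} {th de : P -> P -> P} (p q : P) :
  pa_F th de p q -> pa_F de th q p.
Proof. intros [H1 H2]; split; assumption. Qed.

Lemma pa_th_le {P : Type} {th de : P -> P -> P} : is_proj_alg th de ->
  forall p x, pa_le th (th p x) p.
Proof.
  intros (T1 & D1 & T2 & D2 & T3 & D3 & TD & DT & T4 & D4) p x; unfold pa_le.
  rewrite <- (TD p x) at 2; rewrite DT, TD; reflexivity.
Qed.

Lemma pa_de_le {P : Type} {th de : P -> P -> P} : is_proj_alg th de ->
  forall p x, pa_le th (de p x) p.
Proof.
  intros H p x; apply (pa_le_dual H), (pa_th_le (pa_dual H)).
Qed.

Lemma pa_le_refl {P : Type} {th de : P -> P -> P} : is_proj_alg th de ->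
  forall p, pa_le th p p.
Proof. intros H p; symmetry; apply H. Qed.

Lemma pa_le_th' {P : Type} {th de : P -> P -> P} : is_proj_alg th de ->
  forall p q, pa_le th p q -> th p q = p.
Proof.
  intros (T1 & D1 & T2 & D2 & T3 & D3 & TD & DT & T4 & D4) p q H.
  unfold pa_le in H; rewrite H at 1; rewrite T2, <- H; reflexivity.
Qed.

Lemma pa_le_de {P : Type} {th de : P -> P -> P} : is_proj_alg th de ->
  forall p q, pa_le th p q -> de q p = p.
Proof. intros H p q Hle; symmetry; apply (pa_le_dual H), Hle. Qed.

Lemma pa_le_de' {P : Type} {th de : P -> P -> P} : is_proj_alg th de ->
  forall p q, pa_le th p q -> de p q = p.
Proof. intros H p q Hle; apply (pa_le_th' (pa_dual H)), (pa_le_dual H), Hle. Qed.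

(** In operator form θ_qθ_p = θ_p: since pδ_q = p, the axiom θ_(pδ_q)θ_p = θ_qθ_p reduces it to
    idempotence of θ_p. *)
Lemma pa_le_absorb {P : Type} {th de : P -> P -> P} : is_proj_alg th de ->
  forall p q x, pa_le th p q -> th p (th q x) = th p x.
Proof.
  intros H p q x Hle; pose proof (pa_le_de H _ _ Hle) as E.
  pose proof (pa_th_le H p x) as E'; unfold pa_le in E'.
  destruct H as (T1 & D1 & T2 & D2 & T3 & D3 & TD & DT & T4 & D4).
  rewrite <- (T4 p q x), E, <- E'; reflexivity.
Qed.

Lemma pa_le_fix {P : Type} {th de : P -> P -> P} : is_proj_alg th de ->
  forall p q x, pa_le th p q -> th q (th p x) = th p x.
Proof.
  intros H p q x Hle; pose proof (pa_th_le H p x) as E; unfold pa_le in Hle, E.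
  destruct H as (T1 & D1 & T2 & D2 & T3 & D3 & TD & DT & T4 & D4).
  rewrite <- (T3 q p x), <- Hle; symmetry; exact E.
Qed.

(** Makes the middle factor of every total product a genuine path; in a DRC-semigroup the pair is
    D(pq), R(pq). One half suffices, as swapping θ and δ exchanges the two. *)
Lemma pa_F_base {P : Type} {th de : P -> P -> P} : is_proj_alg th de ->
  forall p q, pa_F th de (de p q) (th q p).
Proof.
  assert (half : forall (th de : P -> P -> P), is_proj_alg th de ->
    forall p q, de p q = de (de p q) (th q p)).
  { clear; intros th de H p q.
    pose proof (pa_le_de' H _ _ (pa_th_le H q p)) as E.
    destruct H as (T1 & D1 & T2 & D2 & T3 & D3 & TD & DT & T4 & D4).
    rewrite <- (TD q p) at 1; rewrite D3, TD.
    rewrite <- E at 1; rewrite D4, D1; reflexivity. }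
  intros H p q; split; [apply half, H|].
  exact (half de th (pa_dual H) q p).
Qed.

Lemma pa_F_rres {P : Type} {th de : P -> P -> P} : is_proj_alg th de ->
  forall p q s, pa_F th de p q -> pa_le th s q -> pa_F th de (de p s) s.
Proof.
  intros H p q s [_ Hq] Hs.
  pose proof (pa_le_absorb H s q p Hs) as E; rewrite <- Hq, (pa_le_th' H _ _ Hs) in E.
  pose proof (pa_le_th' H _ _ (pa_de_le H p s)) as E1.
  destruct H as (T1 & D1 & T2 & D2 & T3 & D3 & TD & DT & T4 & D4).
  split.
  - rewrite <- (D1 s) at 3; rewrite D3, D1; reflexivity.
  - rewrite <- E1, T4, T1; exact E.
Qed.

Lemma pa_F_lres {P : Type} {th de : P -> P -> P} : is_proj_alg th de ->
  forall p q s, pa_F th de p q -> pa_le th s p -> pa_F th de s (th q s).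
Proof.
  intros H p q s HF Hs; apply pa_F_dual.
  apply (pa_F_rres (pa_dual H) q p s); [apply pa_F_dual, HF|].
  apply (pa_le_dual H), Hs.
Qed.

(** Computes the first vertex of the path (qδ_p, pθ_q) after right restriction to tδ_(pθ_q). The
    point is δ_(pθ_q)δ_p = δ_qδ_p, with tδ_q = t. *)
Lemma pa_de_nested {P : Type} {th de : P -> P -> P} : is_proj_alg th de ->
  forall p q t, pa_le th t q -> de (de p q) (de (th q p) t) = de p t.
Proof.
  intros H p q t Ht.
  pose proof (pa_le_de H _ _ Ht) as Et.
  pose proof (pa_le_fix (pa_dual H) (th q p) q t
    (proj1 (pa_le_dual H _ _) (pa_th_le H q p))) as E.
  destruct H as (T1 & D1 & T2 & D2 & T3 & D3 & TD & DT & T4 & D4).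
  rewrite <- E, D3, E, D4, Et; reflexivity.
Qed.

Lemma pa_th_nested {P : Type} {th de : P -> P -> P} : is_proj_alg th de ->
  forall p q t, pa_le th t p -> th (th q p) (th (de p q) t) = th q t.
Proof.
  intros H p q t Ht; apply (pa_de_nested (pa_dual H)), (pa_le_dual H), Ht.
Qed.

(** * Restrictions and the total product in a chained projection category *)

Lemma tcompE {C : Cat} (a b : C) (h : cr a = cd b) : tcomp a b = ccomp a b h.
Proof.
  unfold tcomp; destruct (excluded_middle_informative _) as [h'|n]; [|destruct (n h)].
  rewrite (proof_irrelevance _ h' h); reflexivity.
Qed.

Lemma cd_tcomp {C : Cat} (a b : C) : cr a = cd b -> cd (tcomp a b) = cd a.
Proof. intros h; rewrite (tcompE a b h); apply cat_dcomp. Qed.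

Lemma cr_tcomp {C : Cat} (a b : C) : cr a = cd b -> cr (tcomp a b) = cr b.
Proof. intros h; rewrite (tcompE a b h); apply cat_rcomp. Qed.

Lemma tcomp_assoc {C : Cat} (a b c : C) : cr a = cd b -> cr b = cd c ->
  tcomp a (tcomp b c) = tcomp (tcomp a b) c.
Proof.
  intros h1 h2.
  assert (h3 : cr a = cd (tcomp b c)) by (rewrite cd_tcomp; assumption).
  assert (h4 : cr (tcomp a b) = cd c) by (rewrite cr_tcomp; assumption).
  rewrite (tcompE _ _ h3), (tcompE _ _ h4).
  revert h3 h4; rewrite (tcompE _ _ h1), (tcompE _ _ h2); intros; apply cat_assoc.
Qed.

Lemma tcomp_idl {C : Cat} (p a : C) : cd a = p -> tcomp p a = a.
Proof. intros <-; rewrite (tcompE _ _ (cat_rd C a)); apply cat_idl. Qed.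

Lemma tcomp_idr {C : Cat} (a p : C) : cr a = p -> tcomp a p = a.
Proof. intros <-; rewrite (tcompE _ _ (eq_sym (cat_dr a))); apply cat_idr. Qed.

Lemma Ob_r {C : Cat} (p : Ob C) : cr (proj1_sig p) = proj1_sig p.
Proof. destruct p as [p h]; cbn; rewrite <- h; apply cat_rd. Qed.

Lemma ob_d_Ob {C : Cat} (p : Ob C) : ob_d (proj1_sig p) = p.
Proof. apply Ob_eq; exact (proj2_sig p). Qed.

Lemma ob_r_Ob {C : Cat} (p : Ob C) : ob_r (proj1_sig p) = p.
Proof. apply Ob_eq, Ob_r. Qed.

Lemma lel_ob {C : ProjCat} (a b : C) : lel a b ->
  pa_le (@pth C) (ob_d a) (ob_d b) /\ pa_le (@pth C) (ob_r a) (ob_r b).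
Proof.
  intros H; destruct (bc_left C) as (_ & H2 & _); destruct (H2 _ _ H).
  split; apply pc_lel; assumption.
Qed.

Lemma ler_ob {C : ProjCat} (a b : C) : ler a b ->
  pa_le (@pth C) (ob_d a) (ob_d b) /\ pa_le (@pth C) (ob_r a) (ob_r b).
Proof.
  intros H; destruct (bc_right C) as (_ & H2 & _); destruct (H2 _ _ H).
  split; apply pc_ler; assumption.
Qed.

Lemma lres_spec {C : ProjCat} (a : C) (p : Ob C) : pa_le (@pth C) p (ob_d a) ->
  lel (lres (proj1_sig p) a) a /\ cd (lres (proj1_sig p) a) = proj1_sig p.
Proof.
  intros H; unfold lres; apply epsilon_spec.
  destruct (bc_left C) as (_ & _ & _ & H4).
  destruct (H4 a (proj1_sig p) (proj2_sig p)) as [u [Hu _]]; [|exists u; exact Hu].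
  apply (pc_lel C p (ob_d a)); exact H.
Qed.

Lemma rres_spec {C : ProjCat} (a : C) (q : Ob C) : pa_le (@pth C) q (ob_r a) ->
  ler (rres a (proj1_sig q)) a /\ cr (rres a (proj1_sig q)) = proj1_sig q.
Proof.
  intros H; unfold rres; apply epsilon_spec.
  destruct (bc_right C) as (_ & _ & _ & H4).
  destruct (H4 a (proj1_sig q) (proj2_sig q)) as [u [Hu _]]; [|exists u; exact Hu].
  apply (pc_ler C q (ob_r a)); exact H.
Qed.

Lemma lres_eq {C : ProjCat} (a u : C) (p : Ob C) :
  lel u a -> cd u = proj1_sig p -> lres (proj1_sig p) a = u.
Proof.
  intros Hu Hp.
  assert (H : pa_le (@pth C) p (ob_d a)).
  { replace p with (ob_d u) by (apply Ob_eq; exact Hp); apply lel_ob, Hu. }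
  destruct (bc_left C) as (_ & _ & _ & H4).
  destruct (H4 a (proj1_sig p) (proj2_sig p)) as [v [_ Hv]].
  { apply (pc_lel C p (ob_d a)); exact H. }
  rewrite <- (Hv _ (lres_spec a p H)); apply Hv; auto.
Qed.

Lemma rres_eq {C : ProjCat} (a u : C) (q : Ob C) :
  ler u a -> cr u = proj1_sig q -> rres a (proj1_sig q) = u.
Proof.
  intros Hu Hq.
  assert (H : pa_le (@pth C) q (ob_r a)).
  { replace q with (ob_r u) by (apply Ob_eq; exact Hq); apply ler_ob, Hu. }
  destruct (bc_right C) as (_ & _ & _ & H4).
  destruct (H4 a (proj1_sig q) (proj2_sig q)) as [v [_ Hv]].
  { apply (pc_ler C q (ob_r a)); exact H. }
  rewrite <- (Hv _ (rres_spec a q H)); apply Hv; auto.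
Qed.

Lemma lel_refl {C : BiCat} (a : C) : lel a a.
Proof. apply (bc_left C). Qed.

Lemma ler_refl {C : BiCat} (a : C) : ler a a.
Proof. apply (bc_right C). Qed.

Lemma lel_trans {C : BiCat} (a b c : C) : lel a b -> lel b c -> lel a c.
Proof. destruct (bc_left C) as ((_ & _ & H) & _); apply H. Qed.

Lemma ler_trans {C : BiCat} (a b c : C) : ler a b -> ler b c -> ler a c.
Proof. destruct (bc_right C) as ((_ & _ & H) & _); apply H. Qed.

Lemma lres_id {C : ProjCat} (a : C) : lres (cd a) a = a.
Proof. exact (lres_eq a a (ob_d a) (lel_refl a) eq_refl). Qed.

Lemma rres_id {C : ProjCat} (a : C) : rres a (cr a) = a.
Proof. exact (rres_eq a a (ob_r a) (ler_refl a) eq_refl). Qed.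

Lemma ob_d_lres {C : ProjCat} (a : C) (p : Ob C) : pa_le (@pth C) p (ob_d a) ->
  ob_d (lres (proj1_sig p) a) = p.
Proof. intros H; apply Ob_eq; exact (proj2 (lres_spec a p H)). Qed.

Lemma ob_r_rres {C : ProjCat} (a : C) (q : Ob C) : pa_le (@pth C) q (ob_r a) ->
  ob_r (rres a (proj1_sig q)) = q.
Proof. intros H; apply Ob_eq; exact (proj2 (rres_spec a q H)). Qed.

Lemma lres_lres {C : ProjCat} (a : C) (p q : Ob C) :
  pa_le (@pth C) q (ob_d a) -> pa_le (@pth C) p q ->
  lres (proj1_sig p) (lres (proj1_sig q) a) = lres (proj1_sig p) a.
Proof.
  intros Hq Hp; symmetry; apply lres_eq.
  - apply lel_trans with (lres (proj1_sig q) a); [|apply lres_spec, Hq].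
    apply lres_spec; rewrite (ob_d_lres a q Hq); exact Hp.
  - apply lres_spec; rewrite (ob_d_lres a q Hq); exact Hp.
Qed.

Lemma rres_rres {C : ProjCat} (a : C) (p q : Ob C) :
  pa_le (@pth C) q (ob_r a) -> pa_le (@pth C) p q ->
  rres (rres a (proj1_sig q)) (proj1_sig p) = rres a (proj1_sig p).
Proof.
  intros Hq Hp; symmetry; apply rres_eq.
  - apply ler_trans with (rres a (proj1_sig q)); [|apply rres_spec, Hq].
    apply rres_spec; rewrite (ob_r_rres a q Hq); exact Hp.
  - apply rres_spec; rewrite (ob_r_rres a q Hq); exact Hp.
Qed.

(** Monotonicity of composition puts the right side below the composite, and uniqueness of
    restrictions does the rest. *)
Lemma lres_tcomp {C : ProjCat} (a b : C) (p : Ob C) :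
  cr a = cd b -> pa_le (@pth C) p (ob_d a) ->
  lres (proj1_sig p) (tcomp a b)
  = tcomp (lres (proj1_sig p) a) (lres (cr (lres (proj1_sig p) a)) b).
Proof.
  intros h Hp; set (u := lres (proj1_sig p) a).
  destruct (lres_spec a p Hp) as [Hu Du]; fold u in Hu, Du.
  assert (Hb : pa_le (@pth C) (ob_r u) (ob_d b)).
  { replace (ob_d b) with (ob_r a) by (apply Ob_eq; exact h); apply (lel_ob _ _ Hu). }
  destruct (lres_spec b (ob_r u) Hb) as [Hv Dv]; cbn [ob_r proj1_sig] in Hv, Dv.
  apply lres_eq.
  - rewrite (tcompE _ _ h), (tcompE _ _ (eq_sym Dv)).
    destruct (bc_left C) as (_ & _ & H3 & _); apply H3; assumption.
  - rewrite cd_tcomp; auto.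
Qed.

Lemma rres_tcomp {C : ProjCat} (a b : C) (q : Ob C) :
  cr a = cd b -> pa_le (@pth C) q (ob_r b) ->
  rres (tcomp a b) (proj1_sig q)
  = tcomp (rres a (cd (rres b (proj1_sig q)))) (rres b (proj1_sig q)).
Proof.
  intros h Hq; set (u := rres b (proj1_sig q)).
  destruct (rres_spec b q Hq) as [Hu Ru]; fold u in Hu, Ru.
  assert (Ha : pa_le (@pth C) (ob_d u) (ob_r a)).
  { replace (ob_r a) with (ob_d b) by (apply Ob_eq; auto); apply (ler_ob _ _ Hu). }
  destruct (rres_spec a (ob_d u) Ha) as [Hv Rv]; cbn [ob_d proj1_sig] in Hv, Rv.
  apply rres_eq.
  - rewrite (tcompE _ _ h), (tcompE _ _ Rv).
    destruct (bc_right C) as (_ & _ & H3 & _); apply H3; assumption.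
  - rewrite cr_tcomp; auto.
Qed.

(* ε[p, q]; the junk value p when p and q are not F-related. *)
Definition ev {C : CPCat} (p q : Ob C) : C :=
  match excluded_middle_informative (pa_F (@pth C) (@pde C) p q) with
  | left h => ceps (path2 p q h)
  | right _ => proj1_sig p
  end.

Lemma evE {C : CPCat} (w : Path C) p q : proj1_sig w = [p; q] -> ceps w = ev p q.
Proof.
  intros H; pose proof (path_chain w _ H) as [HF _]; unfold ev.
  destruct (excluded_middle_informative _) as [h|n]; [|destruct (n HF)].
  destruct w as [l hl]; cbn in H; subst l.
  unfold path2; do 2 f_equal; apply proof_irrelevance.
Qed.

Lemma ev_path2 {C : CPCat} (p q : Ob C) (h : pa_F (@pth C) (@pde C) p q) :
  ceps (path2 p q h) = ev p q.
Proof. apply evE; reflexivity. Qed.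

Lemma ev_d {C : CPCat} (p q : Ob C) : pa_F (@pth C) (@pde C) p q -> cd (ev p q) = proj1_sig p.
Proof.
  intros h; rewrite <- (ev_path2 p q h).
  destruct (cpc_eval C) as (H & _); exact (H (path2 p q h) p [q] eq_refl).
Qed.

Lemma ev_r {C : CPCat} (p q : Ob C) : pa_F (@pth C) (@pde C) p q -> cr (ev p q) = proj1_sig q.
Proof.
  intros h; rewrite <- (ev_path2 p q h).
  destruct (cpc_eval C) as (_ & H & _); exact (H (path2 p q h) q [p] eq_refl).
Qed.

Lemma pa_F_refl {P : Type} {th de : P -> P -> P} : is_proj_alg th de -> forall p, pa_F th de p p.
Proof. intros (T1 & D1 & _) p; split; auto. Qed.

Lemma ev_refl {C : CPCat} (p : Ob C) : ev p p = proj1_sig p.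
Proof.
  rewrite <- (ev_path2 p p (pa_F_refl (pc_pa C) p)).
  destruct (cpc_eval C) as (_ & _ & _ & H & _); apply H; reflexivity.
Qed.

Lemma ev_lres {C : CPCat} (p q s : Ob C) :
  pa_F (@pth C) (@pde C) p q -> pa_le (@pth C) s p ->
  lres (proj1_sig s) (ev p q) = ev s (pth C q s).
Proof.
  intros h Hs; pose proof (pa_F_lres (pc_pa C) p q s h Hs) as h'.
  apply lres_eq; [|apply ev_d, h'].
  rewrite <- (ev_path2 _ _ h), <- (ev_path2 _ _ h').
  destruct (cpc_eval C) as (_ & _ & _ & _ & _ & H & _).
  apply (H _ _ p [q] s); auto.
Qed.

Lemma ev_rres {C : CPCat} (p q s : Ob C) :
  pa_F (@pth C) (@pde C) p q -> pa_le (@pth C) s q ->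
  rres (ev p q) (proj1_sig s) = ev (pde C p s) s.
Proof.
  intros h Hs; pose proof (pa_F_rres (pc_pa C) p q s h Hs) as h'.
  apply rres_eq; [|apply ev_r, h'].
  rewrite <- (ev_path2 _ _ h), <- (ev_path2 _ _ h').
  destruct (cpc_eval C) as (_ & _ & _ & _ & _ & _ & H).
  apply (H _ _ q [p] s); auto.
Qed.

(** * The total product and its associativity *)

Definition bullet {C : CPCat} (a b : C) : C :=
  let p := pde C (ob_r a) (ob_d b) in
  let q := pth C (ob_d b) (ob_r a) in
  tcomp (tcomp (rres a (proj1_sig p)) (ev p q)) (lres (proj1_sig q) b).

Lemma bullet_ok {C : CPCat} (a b : C) :
  let p := pde C (ob_r a) (ob_d b) in
  let q := pth C (ob_d b) (ob_r a) in
  cr (rres a (proj1_sig p)) = cd (ev p q) /\ cr (ev p q) = cd (lres (proj1_sig q) b).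
Proof.
  intros p q; pose proof (pa_F_base (pc_pa C) (ob_r a) (ob_d b)) as HF.
  fold p q in HF; split.
  - rewrite (ev_d _ _ HF); apply rres_spec, (pa_de_le (pc_pa C)).
  - rewrite (ev_r _ _ HF); symmetry; apply lres_spec, (pa_th_le (pc_pa C)).
Qed.

Lemma bullet_ob_d {C : CPCat} (a b : C) : ob_d (bullet a b) = Delta (pde C) a (ob_d b).
Proof.
  destruct (bullet_ok a b) as [h1 h2]; apply Ob_eq; cbn.
  unfold bullet; rewrite cd_tcomp, cd_tcomp; auto; rewrite cr_tcomp; auto.
Qed.

Lemma bullet_ob_r {C : CPCat} (a b : C) : ob_r (bullet a b) = Theta (pth C) b (ob_r a).
Proof.
  destruct (bullet_ok a b) as [h1 h2]; apply Ob_eq; cbn.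
  unfold bullet; rewrite cr_tcomp; auto; rewrite cr_tcomp; auto.
Qed.

Lemma bulletE {C : CPCat} (a b : C) : bullet a b =
  tcomp (tcomp (rres a (proj1_sig (pde C (ob_r a) (ob_d b))))
               (ev (pde C (ob_r a) (ob_d b)) (pth C (ob_d b) (ob_r a))))
        (lres (proj1_sig (pth C (ob_d b) (ob_r a))) b).
Proof. reflexivity. Qed.

Lemma Delta_le {C : ProjCat} (a : C) (s : Ob C) : pa_le (pth C) (Delta (pde C) a s) (ob_d a).
Proof. apply (ler_ob _ a), rres_spec, (pa_de_le (pc_pa C)). Qed.

Lemma Theta_le {C : ProjCat} (a : C) (p : Ob C) : pa_le (pth C) (Theta (pth C) a p) (ob_r a).
Proof. apply (lel_ob _ a), lres_spec, (pa_th_le (pc_pa C)). Qed.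

Lemma rres_bullet {C : CPCat} (a b : C) (s : Ob C) :
  let q' := pth C (ob_d b) (ob_r a) in
  let f1 := pde C (Theta (pth C) b (ob_r a)) s in
  let e := pde C (ob_r a) (Delta (pde C) b s) in
  let e1 := pde C q' (Delta (pde C) b s) in
  let x := rres (lres (proj1_sig q') b) (proj1_sig f1) in
  rres (bullet a b) (proj1_sig f1) = tcomp (tcomp (rres a (proj1_sig e)) (ev e e1)) x
  /\ cd x = proj1_sig e1 /\ cr x = proj1_sig f1
  /\ pa_F (pth C) (pde C) e e1.
Proof.
  set (p := ob_r a); set (q := ob_d b); set (t := Delta (pde C) b s).
  set (g := Theta (pth C) b p); intros q' f1 e e1 x.
  pose proof (pc_pa C) as PA; destruct (bullet_ok a b) as [h1 h2]; fold p q in h1, h2.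
  pose proof (pa_F_base PA p q) as HF; fold q' in h1, h2, HF.
  set (p' := pde C p q) in *.
  assert (Hq' : pa_le (pth C) q' q) by apply (pa_th_le PA).
  assert (Hp' : pa_le (pth C) p' p) by apply (pa_de_le PA).
  assert (Hf1 : pa_le (pth C) f1 (ob_r (lres (proj1_sig q') b))) by apply (pa_de_le PA).
  assert (Hx : ob_d x = e1).
  (* By conversion, the domain of x is sΔ of the left restriction of b to q', which (C1) turns into
     sΔ_b δ_q' = e1. *)
  { exact (proj2 (pc_C1 C b q' (ob_r b) Hq' (pa_le_refl PA _)) s). }
  assert (He1 : pa_le (pth C) e1 q') by apply (pa_de_le PA).
  assert (Hm : ob_r (ev p' q') = q') by (apply Ob_eq, ev_r, HF).
  assert (He : pde C p' e1 = e) by apply (pa_de_nested PA), Delta_le.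
  assert (Hee : pa_F (pth C) (pde C) e e1).
  { rewrite <- He; apply (pa_F_rres PA p' q' e1 HF He1). }
  split; [|split; [|split; [|exact Hee]]].
  - rewrite bulletE; fold p q p' q'.
    rewrite rres_tcomp; [|rewrite cr_tcomp; assumption|exact Hf1].
    fold x; f_equal; change (cd x) with (proj1_sig (ob_d x)); rewrite Hx.
    rewrite rres_tcomp; [|assumption|rewrite Hm; exact He1].
    rewrite (ev_rres p' q' e1 HF He1), He, (ev_d _ _ Hee).
    rewrite rres_rres; [reflexivity|exact Hp'|].
    rewrite <- He; apply (pa_de_le PA).
  - exact (f_equal (@proj1_sig _ _) Hx).
  - apply rres_spec, Hf1.
Qed.

Lemma lres_bullet {C : CPCat} (b c : C) (p : Ob C) :
  let s := ob_d c in
  let s1 := pde C (ob_r b) s in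
  let g := Theta (pth C) b p in
  let e2 := pth C (Delta (pde C) b s) p in
  let f := pth C s g in
  let f2 := pth C s1 g in
  let y := lres (proj1_sig e2) (rres b (proj1_sig s1)) in
  lres (proj1_sig e2) (bullet b c) = tcomp y (tcomp (ev f2 f) (lres (proj1_sig f) c))
  /\ cd y = proj1_sig e2 /\ cr y = proj1_sig f2
  /\ pa_F (pth C) (pde C) f2 f.
Proof.
  set (r := ob_r b); intros s; set (t := Delta (pde C) b s); intros s1 g e2 f f2 y.
  pose proof (pc_pa C) as PA; destruct (bullet_ok b c) as [h1 h2]; fold r s s1 in h1, h2.
  pose proof (pa_F_base PA r s) as HF; fold s1 in HF.
  set (s' := pth C s r) in *.
  assert (Hs' : pa_le (pth C) s' s) by apply (pa_th_le PA).
  assert (Hs1 : pa_le (pth C) s1 r) by apply (pa_de_le PA).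
  assert (He2 : pa_le (pth C) e2 (ob_d (rres b (proj1_sig s1)))) by apply (pa_th_le PA).
  assert (Hy : ob_r y = f2).
  { exact (proj1 (pc_C1 C b (ob_d b) s1 (pa_le_refl PA _) Hs1) p). }
  assert (Hf2 : pa_le (pth C) f2 s1) by apply (pa_th_le PA).
  assert (Hm : ob_d (ev s1 s') = s1) by (apply Ob_eq, ev_d, HF).
  assert (Hf : pth C s' f2 = f) by apply (pa_th_nested PA), Theta_le.
  assert (Hff : pa_F (pth C) (pde C) f2 f).
  { rewrite <- Hf; apply (pa_F_lres PA s1 s' f2 HF Hf2). }
  split; [|split; [|split; [|exact Hff]]].
  - rewrite bulletE; fold r s s1 s'.
    rewrite <- tcomp_assoc; [|assumption|assumption].
    rewrite lres_tcomp; [|rewrite cd_tcomp; assumption|exact He2].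
    fold y; f_equal; change (cr y) with (proj1_sig (ob_r y)); rewrite Hy.
    rewrite lres_tcomp; [|assumption|rewrite Hm; exact Hf2].
    rewrite (ev_lres s1 s' f2 HF Hf2), Hf, (ev_r _ _ Hff).
    rewrite lres_lres; [reflexivity|exact Hs'|].
    rewrite <- Hf; apply (pa_th_le PA).
  - apply lres_spec, He2.
  - exact (f_equal (@proj1_sig _ _) Hy).
Qed.

Lemma tcomp_regroup_l {C : Cat} (a u x v : C) :
  cr a = cd u -> cr u = cd x -> cr x = cd v ->
  tcomp (tcomp (tcomp a u) x) v = tcomp a (tcomp (tcomp u x) v).
Proof.
  intros h1 h2 h3.
  rewrite <- (tcomp_assoc a u x), <- (tcomp_assoc a (tcomp u x) v);
    rewrite ?cd_tcomp, ?cr_tcomp; auto.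
Qed.

Lemma tcomp_regroup_r {C : Cat} (a u x v w : C) :
  cr a = cd u -> cr u = cd x -> cr x = cd v -> cr v = cd w ->
  tcomp (tcomp a u) (tcomp x (tcomp v w)) = tcomp (tcomp a (tcomp (tcomp u x) v)) w.
Proof.
  intros h1 h2 h3 h4.
  rewrite <- (tcomp_regroup_l a u x v h1 h2 h3).
  rewrite <- (tcomp_assoc (tcomp (tcomp a u) x) v w), <- (tcomp_assoc (tcomp a u) x);
    rewrite ?cd_tcomp, ?cr_tcomp; auto.
  rewrite cr_tcomp; auto.
Qed.

Lemma bullet_assoc {C : CPCat} (a b c : C) :
  bullet a (bullet b c) = bullet (bullet a b) c.
Proof.
  pose proof (pc_pa C) as PA.
  rewrite (bulletE (bullet a b) c), (bulletE a (bullet b c)), bullet_ob_r, bullet_ob_d.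
  destruct (rres_bullet a b (ob_d c)) as (E1 & Dx & Rx & Fe).
  destruct (lres_bullet b c (ob_r a)) as (E2 & Dy & Ry & Ff).
  rewrite E1, E2; clear E1 E2.
  set (p := ob_r a) in *; set (s := ob_d c) in *.
  (* (e, e2) and (f1, f) are the middle paths of the outer products a • (b • c) and (a • b) • c; (e,
     e1) and (f2, f) are the restricted middle paths of the inner products. *)
  pose proof (pa_F_base PA p (Delta (pde C) b s)) as Fe2.
  pose proof (pa_F_base PA (Theta (pth C) b p) s) as Ff1.
  pose proof (cpc_C2 C b p s (path2 _ _ Fe) (path2 _ _ Ff1) (path2 _ _ Fe2) (path2 _ _ Ff)
    eq_refl eq_refl eq_refl eq_refl) as HC2.
  rewrite !ev_path2 in HC2.
  assert (Ha : cr (rres a (proj1_sig (pde C p (Delta (pde C) b s))))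
    = proj1_sig (pde C p (Delta (pde C) b s))) by (apply rres_spec, (pa_de_le PA)).
  assert (Hc : cd (lres (proj1_sig (pth C s (Theta (pth C) b p))) c)
    = proj1_sig (pth C s (Theta (pth C) b p))) by (apply lres_spec, (pa_th_le PA)).
  pose proof (ev_d _ _ Fe) as De; pose proof (ev_r _ _ Fe) as Re.
  pose proof (ev_d _ _ Fe2) as De2; pose proof (ev_r _ _ Fe2) as Re2.
  pose proof (ev_d _ _ Ff) as Df; pose proof (ev_r _ _ Ff) as Rf.
  pose proof (ev_d _ _ Ff1) as Df1; pose proof (ev_r _ _ Ff1) as Rf1.
  set (x := rres (lres _ b) _) in *; set (y := lres _ (rres b _)) in *.
  rewrite tcomp_regroup_r, <- HC2, (tcomp_regroup_l _ _ x); congruence.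
Qed.

(** * Restriction and composition as instances of the product *)

Lemma rres_Ob {C : ProjCat} (p q : Ob C) : pa_le (pth C) q p ->
  rres (proj1_sig p) (proj1_sig q) = proj1_sig q.
Proof. intros H; apply rres_eq; [apply pc_ler, H|apply Ob_r]. Qed.

Lemma lres_Ob {C : ProjCat} (p q : Ob C) : pa_le (pth C) q p ->
  lres (proj1_sig q) (proj1_sig p) = proj1_sig q.
Proof. intros H; apply lres_eq; [apply pc_lel, H|exact (proj2_sig q)]. Qed.

Lemma bullet_Ob {C : CPCat} (p q : Ob C) :
  bullet (proj1_sig p) (proj1_sig q) = ev (pde C p q) (pth C q p).
Proof.
  pose proof (pc_pa C) as PA; pose proof (pa_F_base PA p q) as HF.
  rewrite bulletE, ob_r_Ob, ob_d_Ob.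
  rewrite (rres_Ob _ _ (pa_de_le PA p q)), (lres_Ob _ _ (pa_th_le PA q p)).
  rewrite (tcomp_idl _ _ (ev_d _ _ HF)); apply tcomp_idr, ev_r, HF.
Qed.

(** When p ≤ d(a) the middle path degenerates to (p, p), which ε sends to the identity p. The same
    collapse underlies the next two lemmas. *)
Lemma bullet_lres {C : CPCat} (p : Ob C) (a : C) : pa_le (pth C) p (ob_d a) ->
  bullet (proj1_sig p) a = lres (proj1_sig p) a.
Proof.
  intros H; pose proof (pc_pa C) as PA.
  rewrite bulletE, ob_r_Ob, (pa_le_de' PA _ _ H), <- H, ev_refl.
  rewrite (rres_Ob _ _ (pa_le_refl PA p)), (tcomp_idl _ (proj1_sig p) (proj2_sig p)).
  apply tcomp_idl, lres_spec, H.
Qed.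

Lemma bullet_rres {C : CPCat} (a : C) (q : Ob C) : pa_le (pth C) q (ob_r a) ->
  bullet a (proj1_sig q) = rres a (proj1_sig q).
Proof.
  intros H; pose proof (pc_pa C) as PA.
  rewrite bulletE, ob_d_Ob, (pa_le_th' PA _ _ H), (pa_le_de PA _ _ H), ev_refl.
  destruct (rres_spec a q H) as [_ R].
  rewrite (lres_Ob _ _ (pa_le_refl PA q)), !(tcomp_idr _ _ R); reflexivity.
Qed.

Lemma bullet_tcomp {C : CPCat} (a b : C) : cr a = cd b -> bullet a b = tcomp a b.
Proof.
  intros h; pose proof (pc_pa C) as PA.
  assert (E : ob_r a = ob_d b) by (apply Ob_eq; exact h).
  destruct (pa_F_refl PA (ob_d b)) as [Ed Et].
  rewrite bulletE, E, <- Ed, <- Et, ev_refl; cbn [ob_d proj1_sig].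
  rewrite lres_id, <- h, rres_id, (tcomp_idr a (cr a) eq_refl); reflexivity.
Qed.

Lemma bullet_le_l {C : CPCat} (p q : Ob C) : pa_le (pth C) p q ->
  bullet (proj1_sig p) (proj1_sig q) = proj1_sig p.
Proof.
  intros H; rewrite bullet_lres; [apply lres_Ob, H|rewrite ob_d_Ob; exact H].
Qed.

Lemma bullet_le_r {C : CPCat} (p q : Ob C) : pa_le (pth C) p q ->
  bullet (proj1_sig q) (proj1_sig p) = proj1_sig p.
Proof.
  intros H; rewrite bullet_rres; [apply rres_Ob, H|rewrite ob_r_Ob; exact H].
Qed.

Lemma bullet_sandwich {C : CPCat} (p q : Ob C) : pa_le (pth C) p q ->
  proj1_sig p = bullet (bullet (proj1_sig q) (proj1_sig p)) (proj1_sig q).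
Proof. intros H; rewrite (bullet_le_r _ _ H), (bullet_le_l _ _ H); reflexivity. Qed.

(** * The isomorphism *)

Definition cpc_drc (C : CPCat) : DRCsg.
Proof.
  refine {| drc_car := C; drc_mul := bullet; drc_D := cd; drc_R := cr |}.
  - apply bullet_assoc.
  - intros a; rewrite bullet_tcomp; [apply tcomp_idl; reflexivity|apply cat_rd].
  - intros a; rewrite bullet_tcomp; [apply tcomp_idr; reflexivity|symmetry; apply cat_dr].
  (* The domain of a • b is d(b)Δ_a, which sees b only through d(b); dually for the codomain. *)
  - intros a b; apply (f_equal (@proj1_sig _ _) (x := ob_d _) (y := ob_d _)).
    rewrite !bullet_ob_d, (ob_d_Ob (ob_d b) : ob_d (cd b) = ob_d b); reflexivity.
  - intros a b; apply (f_equal (@proj1_sig _ _) (x := ob_r _) (y := ob_r _)).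
    rewrite !bullet_ob_r, (ob_r_Ob (ob_r a) : ob_r (cr a) = ob_r a); reflexivity.
  - intros a b; apply (bullet_sandwich (ob_d (bullet a b)) (ob_d a)).
    rewrite bullet_ob_d; apply Delta_le.
  - intros a b; apply (bullet_sandwich (ob_r (bullet a b)) (ob_r b)).
    rewrite bullet_ob_r; apply Theta_le.
  - apply cat_rd.
  - apply cat_dr.
Defined.

(** * Recovering the semigroup *)

(** Once D(m)R(m) is replaced by m, the outer D(m) and R(m) are absorbed by it, and amb = aR(a) ·
    D(b)b = ab. *)
Lemma mul_decomposition {S : DRCsg} (a b : S) :
  let m := drc_R a ∙ drc_D b in
  a ∙ drc_D m ∙ (drc_D m ∙ drc_R m) ∙ (drc_R m ∙ b) = a ∙ b.
Proof.
  intros m.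
  assert (E : drc_D m ∙ drc_R m = m) by (apply D_mul_R; [apply drc_DR|apply drc_DD]).
  rewrite E, <- (drc_assoc S a), drc_Da, drc_assoc, <- (drc_assoc S a m), drc_aR.
  unfold m; rewrite !drc_assoc, drc_aR, <- drc_assoc, drc_Da; reflexivity.
Qed.

(** With D(b) in place of b, this and its dual make the three factors of the decomposition
    composable. *)
Lemma R_cut {S : DRCsg} (a b : S) :
  drc_R (a ∙ drc_D (drc_R a ∙ b)) = drc_D (drc_R a ∙ b).
Proof.
  rewrite drc_Rab; pose proof (D_mul_absorb_l (drc_R a) b) as E.
  rewrite drc_DR in E; rewrite E; apply drc_RD.
Qed.

Lemma D_cut {S : DRCsg} (a b : S) :
  drc_D (drc_R (a ∙ drc_D b) ∙ b) = drc_R (a ∙ drc_D b).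
Proof. exact (@R_cut (drc_op S) b a). Qed.

Lemma drc_cpc_bullet {S : DRCsg} (a b : S) : bullet (C := drc_cpc S) a b = a ∙ b.
Proof.
  set (p := ob_r (C := drc_cat S) a); set (q := ob_d (C := drc_cat S) b).
  pose proof (pa_F_base (drc_proj_alg S) p q) as HF.
  rewrite <- mul_decomposition.
  etransitivity; [apply (bulletE (C := drc_cpc S))|].
  etransitivity; [|apply drc_tcomp3].
  - apply f_equal2; [apply f_equal2|].
    + apply drc_rres; [apply drc_DD|].
      symmetry; apply D_absorb_proj, drc_DR.
    + etransitivity; [symmetry; exact (ev_path2 (C := drc_cpc S) _ _ HF)|].
      exact (drc_path2 (path2 (C := drc_projcat S) _ _ HF) _ _ eq_refl).
    + apply drc_lres; [apply drc_DR|].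
      symmetry; apply R_absorb_proj, drc_DD.
  - rewrite (D_mul_R (drc_DR S a) (drc_DD b)); apply R_cut.
  - rewrite (D_mul_R (drc_DR S a) (drc_DD b)); symmetry; apply D_cut.
Qed.

Lemma DRCsg_ext (X : Type) (m1 m2 : X -> X -> X) (D1 D2 R1 R2 : X -> X)
  a1 b1 c1 d1 e1 f1 g1 h1 i1 a2 b2 c2 d2 e2 f2 g2 h2 i2 :
  (forall x y, m1 x y = m2 x y) -> D1 = D2 -> R1 = R2 ->
  Build_DRCsg X m1 D1 R1 a1 b1 c1 d1 e1 f1 g1 h1 i1
  = Build_DRCsg X m2 D2 R2 a2 b2 c2 d2 e2 f2 g2 h2 i2.
Proof.
  intros Hm <- <-.
  assert (m1 = m2) as <- by (do 2 (apply functional_extensionality; intro); apply Hm).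
  f_equal; apply proof_irrelevance.
Qed.

Lemma cpc_drc_cpc (S : DRCsg) : cpc_drc (drc_cpc S) = S.
Proof.
  pose proof (@drc_cpc_bullet S) as H; revert H.
  destruct S; intros H; apply DRCsg_ext; auto.
Qed.

(** * Recovering the chained projection category *)

(** Carrier, domain and codomain are shared by both records, so the remaining data can be compared
    without transport. Evaluation maps are compared on equal lists with independent path proofs,
    since each path type refers to its own operations. *)
Lemma CPCat_ext (M : Type) (d r : M -> M) c1 c2
    dd1 rd1 dr1 rr1 dc1 rc1 il1 ir1 as1 dd2 rd2 dr2 rr2 dc2 rc2 il2 ir2 as2
    (l1 l2 r1 r2 : M -> M -> Prop) bl1 br1 ag1 bl2 br2 ag2
    (th1 th2 de1 de2 : {p : M | d p = p} -> {p : M | d p = p} -> {p : M | d p = p})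
    pa1 pl1 pr1 C11 pa2 pl2 pr2 C12 eps1 eps2 ev1 C21 ev2 C22 :
  (forall a b h, c1 a b h = c2 a b h) ->
  (forall a b, l1 a b <-> l2 a b) -> (forall a b, r1 a b <-> r2 a b) ->
  (forall p q, th1 p q = th2 p q) -> (forall p q, de1 p q = de2 p q) ->
  (forall l h1 h2, eps1 (exist _ l h1) = eps2 (exist _ l h2)) ->
  Build_CPCat (Build_ProjCat (Build_BiCat
    (Build_Cat M d r c1 dd1 rd1 dr1 rr1 dc1 rc1 il1 ir1 as1)
    l1 r1 bl1 br1 ag1) th1 de1 pa1 pl1 pr1 C11) eps1 ev1 C21
  = Build_CPCat (Build_ProjCat (Build_BiCat
    (Build_Cat M d r c2 dd2 rd2 dr2 rr2 dc2 rc2 il2 ir2 as2)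
    l2 r2 bl2 br2 ag2) th2 de2 pa2 pl2 pr2 C12) eps2 ev2 C22.
Proof.
  intros Hc Hl Hr Ht Hd He.
  assert (c1 = c2) by (do 3 (apply functional_extensionality_dep; intro); apply Hc).
  assert (l1 = l2)
    by (do 2 (apply functional_extensionality; intro); apply propositional_extensionality, Hl).
  assert (r1 = r2)
    by (do 2 (apply functional_extensionality; intro); apply propositional_extensionality, Hr).
  assert (th1 = th2) by (do 2 (apply functional_extensionality; intro); apply Ht).
  assert (de1 = de2) by (do 2 (apply functional_extensionality; intro); apply Hd).
  subst c2 l2 r2 th2 de2.
  (* Proofs are identified record by record, from [Cat] outwards, until both sides share one
     [ProjCat]. *)
  destruct (proof_irrelevance _ dd1 dd2), (proof_irrelevance _ rd1 rd2),
    (proof_irrelevance _ dr1 dr2), (proof_irrelevance _ rr1 rr2),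
    (proof_irrelevance _ dc1 dc2), (proof_irrelevance _ rc1 rc2),
    (proof_irrelevance _ il1 il2), (proof_irrelevance _ ir1 ir2),
    (proof_irrelevance _ as1 as2).
  destruct (proof_irrelevance _ bl1 bl2), (proof_irrelevance _ br1 br2),
    (proof_irrelevance _ ag1 ag2).
  destruct (proof_irrelevance _ pa1 pa2), (proof_irrelevance _ pl1 pl2),
    (proof_irrelevance _ pr1 pr2), (proof_irrelevance _ C11 C12).
  assert (eps1 = eps2)
    by (apply functional_extensionality; intros [l h]; apply He).
  subst eps2; f_equal; apply proof_irrelevance.
Qed.

Lemma cpc_drc_lel {C : CPCat} (a b : C) : drc_lel (S := cpc_drc C) a b <-> lel a b.
Proof.
  unfold drc_lel; cbn; split.
  - intros [H1 H2].
    assert (Hle : pa_le (pth C) (ob_d a) (ob_d b)).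
    (* [H2] writes d(a) as a product of objects, that is, as an evaluated path starting at
       d(a)δ_(d(b)); comparing domains shows d(a) is that object, which lies below d(b). *)
    { assert (E : ob_d a = pde C (ob_d b) (ob_d a)).
      { apply Ob_eq; cbn.
        rewrite <- (ev_d _ _ (pa_F_base (pc_pa C) (ob_d b) (ob_d a))).
        rewrite <- (bullet_Ob (ob_d b) (ob_d a)); cbn.
        rewrite <- H2, cat_dd; reflexivity. }
      rewrite E; apply (pa_de_le (pc_pa C)). }
    rewrite (eq_trans H1 (bullet_lres (ob_d a) b Hle)); apply lres_spec, Hle.
  - intros H; destruct (lel_ob _ _ H) as [Hle _]; split.
    + etransitivity; [|symmetry; exact (bullet_lres (ob_d a) b Hle)].
      symmetry; apply lres_eq; auto.
    + symmetry; exact (bullet_le_r _ _ Hle).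
Qed.

Lemma cpc_drc_ler {C : CPCat} (a b : C) : drc_ler (S := cpc_drc C) a b <-> ler a b.
Proof.
  unfold drc_ler; cbn; split.
  - intros [H1 H2].
    assert (Hle : pa_le (pth C) (ob_r a) (ob_r b)).
    { assert (E : ob_r a = pth C (ob_r b) (ob_r a)).
      { apply Ob_eq; cbn.
        rewrite <- (ev_r _ _ (pa_F_base (pc_pa C) (ob_r a) (ob_r b))).
        rewrite <- (bullet_Ob (ob_r a) (ob_r b)); cbn.
        rewrite <- H2, cat_rr; reflexivity. }
      rewrite E; apply (pa_th_le (pc_pa C)). }
    rewrite (eq_trans H1 (bullet_rres b (ob_r a) Hle)); apply rres_spec, Hle.
  - intros H; destruct (ler_ob _ _ H) as [_ Hle]; split.
    + etransitivity; [|symmetry; exact (bullet_rres b (ob_r a) Hle)].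
      symmetry; apply rres_eq; auto.
    + symmetry; exact (bullet_le_l _ _ Hle).
Qed.

Lemma cpc_drc_th {C : CPCat} (p q : Ob C) : drc_th (S := cpc_drc C) p q = pth C p q.
Proof.
  apply Ob_eq; cbn; rewrite (bullet_Ob q p); apply ev_r, (pa_F_base (pc_pa C)).
Qed.

Lemma cpc_drc_de {C : CPCat} (p q : Ob C) : drc_de (S := cpc_drc C) p q = pde C p q.
Proof.
  apply Ob_eq; cbn; rewrite (bullet_Ob p q); apply ev_d, (pa_F_base (pc_pa C)).
Qed.

(** Splitting off the first edge, p • ε(y) = ε[p, q] ∘ ε(y): p ℱ q says that the middle path of this
    product is (p, q) itself, so neither outer factor is properly restricted. *)
Lemma cpc_drc_lprod {C : CPCat} (p : Ob C) t (x : Path C) :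
  proj1_sig x = p :: t -> lprod (S := cpc_drc C) p t = ceps x.
Proof.
  destruct (cpc_eval C) as (Hd & Hr & H1 & _ & Hcomp & _).
  revert p x; induction t as [|q t IH]; intros p x Hx.
  - symmetry; apply H1, Hx.
  - destruct (path_chain x _ Hx) as [HF Ht].
    set (y := exist _ (q :: t) (conj (fun H => nil_cons (eq_sym H)) Ht) : Path C).
    assert (h : cr (ceps (path2 p q HF)) = cd (ceps y)).
    { rewrite (Hr (path2 p q HF) q [p] eq_refl); symmetry; apply (Hd y q t eq_refl). }
    cbn [lprod]; rewrite (IH q y eq_refl).
    rewrite (Hcomp (path2 p q HF) y x [p] q t h eq_refl eq_refl Hx).
    rewrite <- (tcompE _ _ h), ev_path2.
    assert (Hy : ob_d (ceps y) = q) by (apply Ob_eq; apply (Hd y q t eq_refl)).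
    change (bullet (proj1_sig p) (ceps y) = tcomp (ev p q) (ceps y)).
    pose proof HF as [Ep Eq].
    rewrite bulletE, ob_r_Ob, Hy, <- Ep, <- Eq, (rres_Ob p p (pa_le_refl (pc_pa C) p)).
    rewrite (tcomp_idl _ _ (ev_d _ _ HF)), (lres_eq (ceps y) (ceps y) q (lel_refl _));
      [reflexivity|exact (Hd y q t eq_refl)].
Qed.

Lemma drc_cpc_drc (C : CPCat) : drc_cpc (cpc_drc C) = C.
Proof.
  pose proof (@cpc_drc_lel C) as Hl; pose proof (@cpc_drc_ler C) as Hr.
  pose proof (@cpc_drc_th C) as Ht; pose proof (@cpc_drc_de C) as Hd.
  assert (Hc : forall (a b : C) h, bullet a b = ccomp a b h)
    by (intros a b h; rewrite (bullet_tcomp a b h); apply tcompE).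
  assert (He : forall l h1 h2,
    path_prod (S := cpc_drc C) (exist _ l h1) = ceps (exist _ l h2 : Path C)).
  { intros [|p t] h1 h2; [destruct (proj1 h1 eq_refl)|].
    exact (cpc_drc_lprod p t (exist _ (p :: t) h2) eq_refl). }
  revert Hl Hr Ht Hd Hc He.
  destruct C as [[[[M d r c dd rd dr rr dc rc il ir asc] l ri bl br ag]
    th de pa pl pr C1] eps ev C2].
  intros; apply CPCat_ext; assumption.
Qed.

(* [a ∙ b] is the composite of the right restriction of [a], an evaluated path
   of length two and the left restriction of [b]; chained projection functors
   preserve all three. *)
Lemma cpc_hom_mul {S T : DRCsg} (g : CPC_hom (drc_cpc S) (drc_cpc T)) (a b : S) :
  (proj1_sig g (a ∙ b) : T) = (proj1_sig g a : T) ∙ (proj1_sig g b : T).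
Proof.
  destruct g as (g & Hd & Hr & Hc & Hlel & Hler & Hp & He); cbn [proj1_sig].
  set (p := ob_r (C := drc_cat S) a); set (q := ob_d (C := drc_cat S) b).
  set (p' := ob_r (C := drc_cat T) (g a)); set (q' := ob_d (C := drc_cat T) (g b)).
  pose proof (pa_F_base (drc_proj_alg S) p q) as HF.
  pose proof (pa_F_base (drc_proj_alg T) p' q') as HF'.
  destruct (Hp q p q' p' (Hd b) (Hr a)) as [Eq _].
  destruct (Hp p q p' q' (Hr a) (Hd b)) as [_ Ep].
  set (m := drc_R a ∙ drc_D b); set (m' := drc_R (g a : T) ∙ drc_D (g b : T)).
  change (drc_R m' = g (drc_R m)) in Eq; change (drc_D m' = g (drc_D m)) in Ep.
  (* By [Ep] and [Eq], g maps the path (D(m), R(m)) to (D(m'), R(m')), and it commutes with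
     evaluation. *)
  assert (Em : g (drc_D m ∙ drc_R m) = drc_D m' ∙ drc_R m').
  { symmetry; apply (He (path2 (C := drc_projcat S) _ _ HF) (path2 (C := drc_projcat T) _ _ HF')).
    cbn; f_equal; [exact Ep|f_equal; exact Eq]. }
  assert (HD : forall x : S, drc_D (g x : T) = g (drc_D x)) by exact Hd.
  assert (HR : forall x : S, drc_R (g x : T) = g (drc_R x)) by exact Hr.
  assert (Hm : forall x y : S, drc_R x = drc_D y -> (g (x ∙ y) : T) = (g x : T) ∙ (g y : T)).
  { intros x y h; refine (Hc x y h _).
    etransitivity; [apply HR|rewrite h; symmetry; apply HD]. }
  clear Hd Hr Hc Hp He.
  assert (Emm : drc_D m ∙ drc_R m = m) by (apply D_mul_R; [apply drc_DR|apply drc_DD]).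
  assert (Ra : drc_R (a ∙ drc_D m) = drc_D m) by apply R_cut.
  assert (Db : drc_D (drc_R m ∙ b) = drc_R m) by apply D_cut.
  (* aD(m) ≤_r a gives g(aD(m)) ≤_r g(a), so g(aD(m)) is g(a) times its own codomain, the image of
     D(m). *)
  assert (Ga : (g (a ∙ drc_D m) : T) = (g a : T) ∙ drc_D m').
  { assert (H : drc_ler (a ∙ drc_D m) a).
    { split; rewrite Ra; [reflexivity|symmetry; apply D_absorb_proj, drc_DR]. }
    apply Hler in H; destruct H as [H _].
    rewrite H at 1; apply f_equal; rewrite Ep.
    etransitivity; [apply HR|rewrite Ra; reflexivity]. }
  assert (Gb : (g (drc_R m ∙ b) : T) = drc_R m' ∙ (g b : T)).
  { assert (H : drc_lel (drc_R m ∙ b) b).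
    { split; rewrite Db; [reflexivity|symmetry; apply R_absorb_proj, drc_DD]. }
    apply Hlel in H; destruct H as [H _].
    rewrite H at 1; apply (f_equal (fun x => drc_mul x (g b : T))); rewrite Eq.
    etransitivity; [apply HD|rewrite Db; reflexivity]. }
  rewrite <- (mul_decomposition a b), <- (mul_decomposition (g a : T) (g b : T)).
  fold m m'; rewrite <- Ga, <- Gb, <- Em.
  rewrite (Hm (_ ∙ _ ∙ (_ ∙ _))), (Hm (_ ∙ _) (_ ∙ _)); rewrite ?Emm; [reflexivity|exact Ra|].
  rewrite Db, drc_Rab, Ra, drc_Da; reflexivity.
Qed.

(* DRC ≅ CPC: a functor F : DRC -> CPC that is bijective on objects and on
   each hom-set (equivalently, an isomorphism of categories). *)
Theorem theorem7p1 :
  exists (F : DRCsg -> CPCat) (Fh : forall S T, DRC_hom S T -> CPC_hom (F S) (F T)),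
    (* F preserves identities *)
    (forall (S : DRCsg) (f : DRC_hom S S),
        (forall x, proj1_sig f x = x) -> forall x, proj1_sig (Fh S S f) x = x) /\
    (* F preserves composition *)
    (forall (S T U : DRCsg) (f : DRC_hom S T) (g : DRC_hom T U) (h : DRC_hom S U),
        (forall x, proj1_sig h x = proj1_sig g (proj1_sig f x)) ->
        forall x, proj1_sig (Fh S U h) x
                  = proj1_sig (Fh T U g) (proj1_sig (Fh S T f) x)) /\
    (* bijective on objects *)
    (forall S T : DRCsg, F S = F T -> S = T) /\
    (forall C : CPCat, exists S : DRCsg, F S = C) /\
    (* bijective on hom-sets *)
    (forall (S T : DRCsg) (f g : DRC_hom S T), Fh S T f = Fh S T g -> f = g) /\
    (forall (S T : DRCsg) (g : CPC_hom (F S) (F T)), exists f, Fh S T f = g).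
Proof.
  assert (sig_eq : forall (A : Type) (P : A -> Prop) (x y : {a | P a}),
    proj1_sig x = proj1_sig y -> x = y).
  { intros A P [x hx] [y hy]; cbn; intros <-; f_equal; apply proof_irrelevance. }
  exists drc_cpc, (@cpc_hom_of).
  repeat apply conj.
  - intros S f H; exact H.
  - intros S T U f g h H; exact H.
  - intros S T H; rewrite <- (cpc_drc_cpc S), <- (cpc_drc_cpc T), H; reflexivity.
  - intros C; exists (cpc_drc C); apply drc_cpc_drc.
  - intros S T f g H; apply sig_eq; exact (f_equal (@proj1_sig _ _) H).
  - intros S T g.
    (* The carrier of [drc_cpc S] is that of [S], so the underlying map of g serves as its own
       preimage. *)
    pose proof (cpc_hom_mul g) as Hm; pose proof (proj2_sig g) as (Hd & Hr & _).
    exists (exist _ (proj1_sig g : S -> T)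
      (conj Hm (conj (fun a => eq_sym (Hd a)) (fun a => eq_sym (Hr a))))).
    apply sig_eq; reflexivity.
Qed.
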